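(* Let $g^{\alpha\beta}$ and $G$ be as in the context, and suppose that $G(\omega^0)<0$ for some $\omega^0\in\mathbb{S}^1$. Then there exists $A\in C_c^\infty(\mathbb{R}\times\mathbb{S}^1)$ with $\operatorname{supp}A\subset(-\infty,1]\times\mathbb{S}^1$ such that the Cauchy problem $$\partial_s(\mu U_q)=0,\qquad \partial_s\mu=\tfrac12G(\omega)\mu^2UU_q,\qquad \lim_{q\to\infty}U(s,q,\omega)=0,\qquad (\mu,U_q)|_{s=0}=(-2,A)$$ blows up at some finite $s_*>0$ (its maximal solution on $s\ge 0$ has lifespan $[0,s_* )$), where the $L^\infty$ norms of $|U|,\kappa,|U_q|$ tend to infinity as $s\to s_*$, in the sense that $$\|\kappa\|_{L^\infty([0,s_* )\times\mathbb{R}\times\mathbb{S}^1)}=\|U\|_{L^\infty([0,s_* )\times\mathbb{R}\times\mathbb{S}^1)}=\|U_q\|_{L^\infty([0,s_* )\times\mathbb{R}\times\mathbb{S}^1)}=\infty.$$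
   Context: Coefficients: $g^{\alpha\beta}=g^{\beta\alpha}$ ($\alpha,\beta\in\{0,1,2\}$) are smooth functions of $u\in\mathbb{R}$ with $g^{00}\equiv-1$ and $g^{\alpha\beta}(u)=m^{\alpha\beta}+g_0^{\alpha\beta}u^2+O(|u|^3)$ for $|u|\le1$, $(m^{\alpha\beta})=\mathrm{diag}(-1,1,1)$, $g_0^{\alpha\beta}$ real constants. For $\omega\in\mathbb{S}^1$, $\widehat\omega=(-1,\omega)$ and $G(\omega):=g_0^{\alpha\beta}\widehat\omega_\alpha\widehat\omega_\beta$. Unknowns are functions $(\mu,U)(s,q,\omega)$ of $(q,\omega)\in\mathbb{R}\times\mathbb{S}^1$ and $s\ge0$. The function $\kappa$ associated with a solution is $\kappa(s,q,\omega)=\exp\big(G(\omega)A(q,\omega)\int_0^sU(s',q,\omega)\,ds'\big)$; one has $\mu=-2\kappa^{-1}$, $U_q=A\kappa$, and the Cauchy problem is equivalent to $\kappa_s(s,q,\omega)=-G(\omega)A(q,\omega)\kappa(s,q,\omega)\int_q^\infty A(q',\omega)\kappa(s,q',\omega)\,dq'$, $\kappa|_{s=0}=1$, regarded as an ODE for $s\mapsto\kappa(s,\cdot)$ with values in a space of continuous functions $C(K\times\mathbb{S}^1)$, where $K$ is a compact interval with $\operatorname{supp}A\subset K\times\mathbb{S}^1$. *)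

(* Defs.v *)
From HB Require Import structures.
From mathcomp Require Import all_boot all_order all_algebra.
From mathcomp Require Import all_classical all_reals all_analysis.

Set Implicit Arguments.
Unset Strict Implicit.
Unset Printing Implicit Defensive.

Import Order.TTheory GRing.Theory Num.Theory.
Import numFieldNormedType.Exports.

Local Open Scope classical_set_scope.
Local Open Scope ring_scope.

Section Coefficients.
Context {R : realType}.

Definition minkowski : 'M[R]_3 := diag_mx (\row_(a < 3) [:: -1; 1; 1]`_a).

Definition smooth (f : R -> R) : Prop :=
  forall (n : nat) (u : R), derivable (derive1n n f) u 1.

Record metric_coefficients (g : 'I_3 -> 'I_3 -> R -> R) (g0 : 'M[R]_3) : Prop :=
  MetricCoefficients {
    coef_smooth : forall a b, smooth (g a b);
    coef_sym : forall a b u, g a b u = g b a u;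
    coef_00 : forall u, g 0 0 u = -1;
    coef_expansion : forall a b, exists C : R, forall u, `|u| <= 1 ->
      `|g a b u - (minkowski a b + g0 a b * u ^+ 2)| <= C * `|u| ^+ 3 }.

(* The unit circle of R * R. A function on the circle is represented by a
   function on R * R, of which only the values on the circle are ever used. *)
Definition circle : set (R * R) := [set w | w.1 ^+ 2 + w.2 ^+ 2 = 1].

Definition angle (t : R) : R * R := (cos t, sin t).

Definition omega_hat (w : R * R) (a : 'I_3) : R := [:: -1; w.1; w.2]`_a.

Definition Gfun (g0 : 'M[R]_3) (w : R * R) : R :=
  \sum_(a < 3) \sum_(b < 3) g0 a b * omega_hat w a * omega_hat w b.

End Coefficients.

Section Initial_data.
Context {R : realType}.

Fixpoint C_k (k : nat) (f : R -> R -> R) : Prop :=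
  continuous (fun x : R * R => f x.1 x.2) /\
  if k is k'.+1 then
    [/\ forall x y, derivable (f^~ y) x 1,
        forall x y, derivable (f x) y 1,
        C_k k' (fun x y => derive1 (f^~ y) x) &
        C_k k' (fun x y => derive1 (f x) y)]
  else True.

(* Smoothness on the manifold R x S^1, read in the angular charts: the map
   t |-> (cos t, sin t) is a local diffeomorphism from R onto the circle. *)
Definition smooth_cylinder (A : R -> R * R -> R) : Prop :=
  forall k : nat, C_k k (fun q t => A q (angle t)).

(* As R x S^1 is closed in R * (R * R), the closure may be taken there. *)
Definition cyl_support (A : R -> R * R -> R) : set (R * (R * R)) :=
  closure [set x | circle x.2 /\ A x.1 x.2 != 0].

Definition smooth_compact_support (A : R -> R * R -> R) : Prop :=
  smooth_cylinder A /\ compact (cyl_support A).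

End Initial_data.

Section Cauchy_problem.
Context {R : realType}.

Definition slab (T : R) : set (R * R * (R * R)) :=
  [set x | 0 <= x.1.1 < T /\ circle x.2].

Definition dq (U : R -> R -> R * R -> R) (s q : R) (w : R * R) : R :=
  derive1 (fun q' => U s q' w) q.

(* Classical solutions on [0, T): everything is continuous up to s = 0, and the
   equations in s hold for 0 < s < T (hence, by continuity, also at s = 0 with
   one-sided derivatives). *)
Record solution (G : R * R -> R) (A : R -> R * R -> R) (T : R)
    (mu U : R -> R -> R * R -> R) : Prop := Solution {
  sol_mu_cont :
    {within slab T, continuous (fun x => mu x.1.1 x.1.2 x.2)};
  sol_U_cont :
    {within slab T, continuous (fun x => U x.1.1 x.1.2 x.2)};
  sol_U_derivable : forall s q w, 0 <= s < T -> circle w ->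
    derivable (fun q' => U s q' w) q 1;
  sol_dqU_cont :
    {within slab T, continuous (fun x => dq U x.1.1 x.1.2 x.2)};
  sol_muUq : forall s q w, 0 < s < T -> circle w ->
    is_derive s 1 (fun s' => mu s' q w * dq U s' q w) 0;
  sol_mu : forall s q w, 0 < s < T -> circle w ->
    is_derive s 1 (fun s' => mu s' q w)
      (2^-1 * G w * mu s q w ^+ 2 * U s q w * dq U s q w);
  sol_lim : forall s w, 0 <= s < T -> circle w ->
    U s q w @[q --> +oo] --> (0 : R);
  sol_init_mu : forall q w, circle w -> mu 0 q w = -2;
  sol_init_Uq : forall q w, circle w -> dq U 0 q w = A q w }.

(* Maximality includes uniqueness: any solution is a restriction of (mu, U). *)
Definition maximal_solution (G : R * R -> R) (A : R -> R * R -> R) (T : R)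
    (mu U : R -> R -> R * R -> R) : Prop :=
  solution G A T mu U /\
  forall (T' : R) (mu' U' : R -> R -> R * R -> R),
    0 < T' -> solution G A T' mu' U' ->
    T' <= T /\
    forall s q w, 0 <= s < T' -> circle w ->
      mu' s q w = mu s q w /\ U' s q w = U s q w.

Definition kappa (G : R * R -> R) (A : R -> R * R -> R)
    (U : R -> R -> R * R -> R) (s q : R) (w : R * R) : R :=
  expR (G w * A q w *
    Rintegral lebesgue_measure `[0, s] (fun s' => U s' q w)).

(* The L^oo norm over [0, T) x R x S^1, where S^1 carries the arc length
   measure, i.e. Lebesgue measure in the angle t in [0, 2 pi). *)
Definition Linfty_norm (T : R) (f : R -> R -> R * R -> R) : \bar R :=
  Lnorm ((@lebesgue_measure R \x @lebesgue_measure R)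
           \x @lebesgue_measure R)%E +oo%E
    (EFin \o ((fun x => f x.1.1 x.1.2 (angle x.2))
       \_ [set x | 0 <= x.1.1 < T /\ 0 <= x.2 < 2 * pi])).

End Cauchy_problem.

(* Main.v *)
(** Take [A(q, w) = a(q) b(w)] with [a] a bump on [[0, 1]] and [b = exp (1 / G)]
where [G < 0], [b = 0] elsewhere. Then [kappa(s, q, w) = K(sigma(w) s, q)] with
[sigma = - G b ^ 2 >= 0] and [U(s, q, w) = - b(w) V(sigma(w) s, q)], where
[(K, V)] solves the problem without parameter [K_t = a K V],
[V(t, q) = int_q^1 a K], [K(0) = 1].  The Taylor coefficients of [K] and [V] in
[t] are nonnegative.  Hence the set of times at which the partial sums are
bounded uniformly in [q] is an interval, it cannot contain its supremum [T]
(a bound [B] at time [t] gives a bound [2 B] at time [t + 1 / (4 B)]), and [T]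
is finite by comparison with the explicit solution for constant [a].  So [K]
blows up at [T], and [s_* = T / max sigma].

Uniqueness: [mu U_q] is constant in [s], hence equal to [- 2 A], which forces
[mu <> 0] and turns the system into an integral equation for [- 2 / mu], to which
a Gronwall argument applies for each fixed [w]. *)
Require Import Defs.
From HB Require Import structures.
From mathcomp Require Import all_boot all_order all_algebra.
From mathcomp Require Import all_classical all_reals all_analysis.
From mathcomp Require Import ess_sup_inf ring lra.

Import Order.TTheory GRing.Theory Num.Theory.
Import numFieldNormedType.Exports.

Local Open Scope classical_set_scope.
Local Open Scope ring_scope.

Set Implicit Arguments.
Unset Strict Implicit.
Unset Printing Implicit Defensive.

(** Nonnegativity of the coefficients replaces an existence theorem for ODEs in a function space.
    Truncated Cauchy products are squeezed between products of truncated sums, so each partial sum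
    satisfies the differential inequality [K_t <= a K V] for [t >= 0], and a bound common to all of
    them moves forward in time before any convergence is known. This is also why the datum is cut
    off in the angle where [G >= 0]: with [sigma >= 0] only nonnegative model times occur, where
    these signs can be used. Unboundedness of [K] does not by itself say anything about [U] or
    [U_q], because [a] vanishes near the ends of its support or beyond. It is passed on in two
    steps: a bounded [V] would bound [K] by a Gronwall estimate, and a bounded [a K] would bound its
    integral [V]. The last unbounded quantity also gives maximality, since a solution living longer
    would have [U_q] bounded on a compact set containing the blow-up. *)

Section Calculus.
Context {R : realType}.
Implicit Types (f g : R -> R) (x y a b : R).

Lemma is_derive_fun_add f g x a b :
  is_derive x 1 f a -> is_derive x 1 g b -> is_derive x 1 (fun y => f y + g y) (a + b).
Proof. exact: is_deriveD. Qed.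

Lemma is_derive_fun_mul f g x a b :
  is_derive x 1 f a -> is_derive x 1 g b ->
  is_derive x 1 (fun y => f y * g y) (a * g x + f x * b).
Proof.
by move=> fa gb; apply: is_derive_eq (is_deriveM fa gb) _; rewrite addrC mulrC.
Qed.

Lemma is_derive_fun_pow f n x a : is_derive x 1 f a ->
  is_derive x 1 (fun y => f y ^+ n) (n%:R * f x ^+ n.-1 * a).
Proof.
move=> fa; rewrite (_ : (fun y => _) = f ^+ n).
  exact: is_derive_eq (is_deriveX n fa) _.
by apply/funext => y; rewrite exprfctE.
Qed.

Lemma is_derive_fun_comp f g x a b :
  is_derive x 1 g b -> is_derive (g x) 1 f a -> is_derive x 1 (fun y => f (g y)) (a * b).
Proof. by move=> gb fa; exact: is_derive1_comp. Qed.

Lemma is_derive_fun_cst c x : is_derive x 1 (fun _ : R => c) (0 : R).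
Proof. exact: is_derive_cst. Qed.

Lemma is_derive_fun_id x : is_derive x 1 (fun y : R => y) (1 : R).
Proof. exact: is_derive_id. Qed.

Lemma is_derive_continuous f x a : is_derive x 1 f a -> {for x, continuous f}.
Proof.
by move=> fa; apply: differentiable_continuous; apply/derivable1_diffP; case: fa.
Qed.

Lemma MVT_everywhere f df a b : (forall x, is_derive x 1 f (df x)) ->
  exists2 c, Num.min a b <= c <= Num.max a b & f b - f a = df c * (b - a).
Proof.
move=> fd; have cf : continuous f by move=> x; exact: is_derive_continuous (fd x).
case: (leP a b) => [ab|/ltW ab].
- have [|c] := @MVT_segment R f df a b ab (fun x _ => fd x).
    exact: continuous_subspaceT.
  by rewrite in_itv /= => cab E; exists c.
- have [|c] := @MVT_segment R f df b a ab (fun x _ => fd x).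
    exact: continuous_subspaceT.
  by rewrite in_itv /= => cab E; exists c => //; lra.
Qed.

End Calculus.

(** * A class of smooth functions *)

Section Flat.
Context {R : realType}.

(** The powers of [1/x] are those produced by differentiating [exp (- 1/x)]: with them the linear
    span of the family is closed under differentiation. *)
Definition flat (n : nat) (x : R) : R :=
  if 0 < x then x^-1 ^+ n * expR (- x^-1) else 0.

Lemma flat_le0 n x : x <= 0 -> flat n x = 0.
Proof. by rewrite /flat leNgt => /negbTE ->. Qed.

Lemma flat_ge0 n x : 0 <= flat n x.
Proof.
rewrite /flat; case: ifP => // x0.
by rewrite mulr_ge0 ?expR_ge0// exprn_ge0// invr_ge0 ltW.
Qed.

Lemma flat_gt0 n x : (0 < flat n x) = (0 < x).
Proof.
rewrite /flat; case: ifP => [x0|_]; last by rewrite ltxx.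
by rewrite mulr_gt0 ?expR_gt0// exprn_gt0// invr_gt0.
Qed.

Lemma flat0_le1 x : flat 0 x <= 1.
Proof.
rewrite /flat; case: ifP => // x0; rewrite expr0 mul1r -expR0 ler_expR.
by rewrite oppr_le0 invr_ge0 ltW.
Qed.

Lemma flatS n x : flat n.+1 x * x = flat n x.
Proof.
rewrite /flat; case: ifP => x0; last by rewrite mul0r.
by rewrite exprS; field; rewrite gt_eqF.
Qed.

(** Put [y = 1/x] in [exp y >= y ^ (n+1) / (n+1)!]. The exponent [n+1] leaves one factor [x], which
    gives continuity at 0. *)
Lemma flat_le_linear n x : `|flat n x| <= n.+1`!%:R * `|x|.
Proof.
rewrite ger0_norm ?flat_ge0// /flat; case: ifP => x0; last by rewrite mulr_ge0.
rewrite (gtr0_norm x0); have y0 : 0 <= x^-1 by rewrite invr_ge0 ltW.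
have := expR_ge1Dxn n y0; set e := expR _ => he.
have f0 : 0 < n.+1`!%:R :> R by rewrite ltr0n fact_gt0.
have e0 : 0 < e by exact: expR_gt0.
have {}he : x^-1 ^+ n.+1 <= n.+1`!%:R * e.
  rewrite mulrC -ler_pdivrMr//; lra.
rewrite expRN -/e ler_pdivrMr// mulrAC -ler_pdivrMr//.
by rewrite mulrC -exprS.
Qed.

Lemma flat_continuous0 n : {for 0, continuous (flat n)}.
Proof.
change (flat n x @[x --> (0:R)] --> flat n 0); rewrite flat_le0//.
apply/norm_cvg0P; apply: (@squeeze_cvgr _ _ _ _ (fun=> 0) (fun x => n.+1`!%:R * `|x|)).
- by near=> x; rewrite normr_ge0 /= flat_le_linear.
- exact: cvg_cst.
- rewrite -[X in _ --> X](mulr0 (n.+1`!%:R)) -[in X in _ --> X](normr0 R).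
  by apply: cvgMr; apply: norm_continuous.
Unshelve. all: by end_near. Qed.

Lemma is_derive_flat n (x : R) :
  is_derive x 1 (flat n) (flat n.+2 x - n%:R * flat n.+1 x).
Proof.
have [x0|x0|->] := ltgtP x 0.
- apply: (@near_eq_is_derive _ _ _ (fun=> 0)); last first.
    by rewrite !flat_le0 ?(ltW x0)// mulr0 subr0; exact: is_derive_cst.
  near=> y; rewrite flat_le0// ltW//; near: y; exact: lt_nbhsl.
- apply: (@near_eq_is_derive _ _ _ (fun y : R => y^-1 ^+ n * expR (- y^-1))).
    near=> y; rewrite /flat ifT//; near: y; exact: lt_nbhsr.
  have xN0 : x != 0 by rewrite gt_eqF.
  have dV : is_derive x 1 (fun y : R => y^-1) (- x ^- 2).
    by apply: is_derive_eq (is_deriveV xN0 (is_derive_fun_id x)) _; rewrite /GRing.scale /= mulr1.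
  have dN := @is_derive_fun_comp _ -%R _ x _ _ dV (@is_deriveNid _ _ _ _).
  have dE := is_derive_fun_comp dN (is_derive_expR _).
  have dX := is_derive_fun_pow n dV.
  apply: is_derive_eq (is_derive_fun_mul dX dE) _.
  rewrite /flat x0.
  case: n dX => [|n] dX; first by rewrite !mul0r !expr0; field.
  by rewrite /= !exprS; field.
(* At 0 the difference quotient of [flat n] is again a member of the family, [flat n.+1], by
   [flatS]. *)
- apply/is_derive1_caratheodory; exists (flat n.+1); split.
  + by move=> z; rewrite (flat_le0 n (lexx 0)) !subr0 flatS.
  + exact: flat_continuous0.
  + by rewrite !flat_le0// mulr0 subr0.
Unshelve. all: by end_near. Qed.

Lemma flat_continuous n : continuous (flat n).
Proof. by move=> x; exact: is_derive_continuous (is_derive_flat n x). Qed.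

End Flat.

Section SmoothClass.
Context {R : realType}.

(* An explicit class of functions of two variables that is closed under both
   partial derivatives, hence consists of smooth functions. *)
Inductive elementary : (R -> R -> R) -> Prop :=
| elementary_cst c : elementary (fun _ _ => c)
| elementary_fst : elementary (fun x _ => x)
| elementary_cos : elementary (fun _ y => cos y)
| elementary_sin : elementary (fun _ y => sin y)
| elementary_add f g : elementary f -> elementary g ->
    elementary (fun x y => f x y + g x y)
| elementary_mul f g : elementary f -> elementary g ->
    elementary (fun x y => f x y * g x y)
| elementary_flat n f : elementary f -> elementary (fun x y => flat n (f x y)).

Lemma elementary_continuous f : elementary f ->
  continuous (fun x : R * R => f x.1 x.2).
Proof.
elim=> {f} [c|||| f g _ cf _ cg| f g _ cf _ cg|n f _ cf] x.
- exact: cvg_cst.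
- exact: cvg_fst.
- by apply: continuous_comp; [exact: cvg_snd|exact: continuous_cos].
- by apply: continuous_comp; [exact: cvg_snd|exact: continuous_sin].
- by apply: continuousD; [exact: cf|exact: cg].
- by apply: continuousM; [exact: cf|exact: cg].
- by apply: (@continuous_comp _ _ _ (fun x : R * R => f x.1 x.2) (flat n));
    [exact: cf|exact: flat_continuous].
Qed.

Lemma elementary_flat_derive n f g : elementary f -> elementary g ->
  elementary (fun x y => (flat n.+2 (f x y) - n%:R * flat n.+1 (f x y)) * g x y).
Proof.
move=> ef eg; apply: elementary_mul => //.
rewrite (_ : (fun _ _ => _) = (fun x y => flat n.+2 (f x y) + (- n%:R) * flat n.+1 (f x y))).
  by repeat constructor.
by apply/funext => x; apply/funext => y; rewrite mulNr.
Qed.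

Lemma elementary_derive_fst f : elementary f ->
  exists2 g, elementary g & forall x y : R, is_derive x 1 (f^~ y) (g x y).
Proof.
elim=> {f} [c|||| f g ef [f' ef' df] eg [g' eg' dg]
  | f g ef [f' ef' df] eg [g' eg' dg]|n f ef [f' ef' df]].
- by exists (fun _ _ => 0); [constructor|move=> x y; exact: is_derive_cst].
- by exists (fun _ _ => 1); [constructor|move=> x y; exact: is_derive_id].
- by exists (fun _ _ => 0); [constructor|move=> x y; exact: is_derive_cst].
- by exists (fun _ _ => 0); [constructor|move=> x y; exact: is_derive_cst].
- exists (fun x y => f' x y + g' x y); first by constructor.
  by move=> x y; exact: is_derive_fun_add.
- exists (fun x y => f' x y * g x y + f x y * g' x y); first by repeat constructor.
  by move=> x y; exact: (is_derive_fun_mul (df x y) (dg x y)).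
- exists (fun x y => (flat n.+2 (f x y) - n%:R * flat n.+1 (f x y)) * f' x y).
    exact: elementary_flat_derive.
  by move=> x y; exact: (is_derive_fun_comp (df x y) (is_derive_flat _ _)).
Qed.

Lemma elementary_derive_snd f : elementary f ->
  exists2 g, elementary g & forall x y : R, is_derive y 1 (f x) (g x y).
Proof.
elim=> {f} [c|||| f g ef [f' ef' df] eg [g' eg' dg]
  | f g ef [f' ef' df] eg [g' eg' dg]|n f ef [f' ef' df]].
- by exists (fun _ _ => 0); [constructor|move=> x y; exact: is_derive_cst].
- by exists (fun _ _ => 0); [constructor|move=> x y; exact: is_derive_cst].
- exists (fun _ y => (-1) * sin y); first by repeat constructor.
  by move=> x y; rewrite mulN1r; exact: is_derive_cos.
- by exists (fun _ y => cos y); [constructor|move=> x y; exact: is_derive_sin].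
- exists (fun x y => f' x y + g' x y); first by constructor.
  by move=> x y; exact: is_derive_fun_add.
- exists (fun x y => f' x y * g x y + f x y * g' x y); first by repeat constructor.
  by move=> x y; exact: (is_derive_fun_mul (df x y) (dg x y)).
- exists (fun x y => (flat n.+2 (f x y) - n%:R * flat n.+1 (f x y)) * f' x y).
    exact: elementary_flat_derive.
  by move=> x y; exact: (is_derive_fun_comp (df x y) (is_derive_flat _ _)).
Qed.

Lemma elementary_C_k k f : elementary f -> C_k k f.
Proof.
elim: k f => [|k IH] f ef; split => //; try exact: elementary_continuous.
have [g eg dg] := elementary_derive_fst ef.
have [h eh dh] := elementary_derive_snd ef.
split.
- by move=> x y; case: (dg x y).
- by move=> x y; case: (dh x y).
- rewrite (_ : (fun x y => _) = g); first exact: IH.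
  apply/funext => x; apply/funext => y.
  by rewrite derive1E; case: (dg x y).
- rewrite (_ : (fun x y => _) = h); first exact: IH.
  apply/funext => x; apply/funext => y.
  by rewrite derive1E; case: (dh x y).
Qed.

End SmoothClass.

(** * Power series *)

Section Series.
Context {R : realType}.

Lemma is_derive_fun_sum (f : nat -> R -> R) (df : nat -> R) (x : R) N :
  (forall i, is_derive x 1 (f i) (df i)) ->
  is_derive x 1 (fun y => \sum_(i < N) f i y) (\sum_(i < N) df i).
Proof.
move=> fd; elim: N => [|N IH].
  rewrite big_ord0 (_ : (fun y => _) = fun=> 0); first exact: is_derive_cst.
  by apply/funext => y; rewrite big_ord0.
rewrite big_ord_recr /= (_ : (fun y => _) = fun y => \sum_(i < N) f i y + f N y).
  exact: is_derive_fun_add.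
by apply/funext => y; rewrite big_ord_recr.
Qed.

Lemma continuous_fun_sum (X : topologicalType) (I : Type) (r : seq I)
    (f : I -> X -> R) (x : X) :
  (forall i, {for x, continuous (f i)}) ->
  {for x, continuous (fun y => \sum_(i <- r) f i y)}.
Proof.
move=> cf; elim: r => [|i r IH].
  rewrite (_ : (fun y => _) = fun=> 0); first exact: cvg_cst.
  by apply/funext => y; rewrite big_nil.
rewrite (_ : (fun y => _) = fun y => f i y + \sum_(j <- r) f j y).
  exact: continuousD.
by apply/funext => y; rewrite big_cons.
Qed.

Lemma cauchy_product_sum (x y : nat -> R) N :
  \sum_(n < N) \sum_(i < n.+1) x i * y (n - i)%N =
  \sum_(i < N) x i * \sum_(j < N - i) y j.
Proof.
elim: N => [|N IH]; first by rewrite !big_ord0.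
rewrite big_ord_recr /= IH [in RHS]big_ord_recr /= subSnn big_ord1.
rewrite big_ord_recr /= subnn addrA -big_split /=; congr (_ + _).
apply: eq_bigr => i _; rewrite -mulrDr subSn 1?ltnW//.
by rewrite [in RHS]big_ord_recr.
Qed.

Lemma sum_ord_le (x : nat -> R) m n : (forall i, 0 <= x i) -> (m <= n)%N ->
  \sum_(i < m) x i <= \sum_(i < n) x i.
Proof.
move=> x0 /subnKC <-; elim: (n - m)%N => [|k IH]; first by rewrite addn0.
by rewrite addnS big_ord_recr /= (le_trans IH)// lerDl.
Qed.

(** The triangle [i + j < N] lies in the square [i, j < N], which in turn lies in the triangle
    [i + j < N + N] of the next lemma. For nonnegative terms these inclusions are inequalities of
    sums. *)
Lemma cauchy_product_le (x y : nat -> R) N :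
  (forall i, 0 <= x i) -> (forall i, 0 <= y i) ->
  \sum_(n < N) \sum_(i < n.+1) x i * y (n - i)%N <=
  (\sum_(i < N) x i) * (\sum_(j < N) y j).
Proof.
move=> x0 y0; rewrite cauchy_product_sum mulr_suml; apply: ler_sum => i _.
by rewrite ler_wpM2l// sum_ord_le// leq_subr.
Qed.

Lemma cauchy_product_ge (x y : nat -> R) N :
  (forall i, 0 <= x i) -> (forall i, 0 <= y i) ->
  (\sum_(i < N) x i) * (\sum_(j < N) y j) <=
  \sum_(n < N + N) \sum_(i < n.+1) x i * y (n - i)%N.
Proof.
move=> x0 y0; rewrite cauchy_product_sum mulr_suml.
apply: (@le_trans _ _ (\sum_(i < N) x i * \sum_(j < N + N - i) y j)).
  apply: ler_sum => i _; rewrite ler_wpM2l// sum_ord_le//.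
  by rewrite leq_subRL ?leq_add2r 1?ltnW// ltn_addl.
apply: (@sum_ord_le (fun i => x i * \sum_(j < N + N - i) y j)); last exact: leq_addr.
by move=> i; rewrite mulr_ge0// sumr_ge0.
Qed.

Lemma cvgn_le_from (u : nat -> R) l c N0 : u @ \oo --> l ->
  (forall N, (N0 <= N)%N -> u N <= c) -> l <= c.
Proof.
move=> ul h; rewrite -(cvg_lim _ ul)//; apply: limr_le.
  by apply/cvg_ex; exists l.
by exists N0.
Qed.

Lemma cvgn_ge_from (u : nat -> R) l c N0 : u @ \oo --> l ->
  (forall N, (N0 <= N)%N -> c <= u N) -> c <= l.
Proof.
move=> ul h; rewrite -(cvg_lim _ ul)//; apply: limr_ge.
  by apply/cvg_ex; exists l.
by exists N0.
Qed.

(** Weierstrass test with a geometric majorant. It is applied with pairs [(t, q)] as points, so that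
    the convergence is uniform in both variables at once. *)
Lemma geometric_tail (X : Type) (P : set X) (c : nat -> X -> R) (B theta : R) :
  0 <= B -> 0 <= theta < 1 ->
  (forall n x, P x -> `|c n x| <= B * theta ^+ n) ->
  (forall x, P x ->
    \sum_(i < N) c i x @[N --> \oo] --> limn (fun N => \sum_(i < N) c i x)) /\
  (forall e, 0 < e -> exists N0, forall N x, (N0 <= N)%N -> P x ->
    `|limn (fun N => \sum_(i < N) c i x) - \sum_(i < N) c i x| <= e).
Proof.
move=> B0 /andP[t0 t1] cB.
have cv x : P x -> cvgn (fun N => \sum_(i < N) c i x).
  move=> Px; rewrite (_ : (fun N => _) = series (fun i => c i x)); last first.
    by apply/funext => N; rewrite /series /= big_mkord.
  apply: normed_cvg; apply: (@series_le_cvg _ _ (fun n => B * theta ^+ n)).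
  - by move=> n; exact: normr_ge0.
  - by move=> n; rewrite mulr_ge0// exprn_ge0.
  - by move=> n; exact: cB.
  - by apply: is_cvg_geometric_series; rewrite ger0_norm.
have d0 : 0 < 1 - theta by rewrite subr_gt0.
split=> [x /cv //|e e0].
(* Splitting off the first term reduces to [N.+1]: [(1 - theta) theta ^ N + theta ^ (N+1) = theta ^
   N]. *)
have geo N k : (1 - theta) * \sum_(i < k) theta ^+ (N + i) <= theta ^+ N.
  elim: k N => [|k IH] N; first by rewrite big_ord0 mulr0 exprn_ge0.
  rewrite big_ord_recl /= addn0 mulrDr.
  under eq_bigr do rewrite /bump /= addnA addn1.
  have := IH N.+1; rewrite exprS; lra.
have tail N k x : P x -> `|\sum_(i < N + k) c i x - \sum_(i < N) c i x| <=
    B * theta ^+ N / (1 - theta).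
  move=> Px; rewrite big_split_ord /= addrAC subrr add0r.
  apply: (le_trans (ler_norm_sum _ _ _)).
  apply: (@le_trans _ _ (\sum_(i < k) B * theta ^+ (N + i))).
    by apply: ler_sum => i _; exact: cB.
  rewrite -mulr_sumr -mulrA ler_wpM2l// ler_pdivlMr// mulrC; exact: geo.
have [N0 hN0] : exists N0, B * theta ^+ N0 / (1 - theta) <= e.
  have : (fun N => B * theta ^+ N / (1 - theta)) @ \oo --> B * 0 / (1 - theta).
    apply: cvgMl; apply: cvgMr; apply: cvg_expr; by rewrite ger0_norm.
  rewrite mulr0 mul0r => /cvgr_le /(_ _ e0) [N0 _ h].
  by exists N0; apply: h => /=.
exists N0 => N x N0N Px.
have hN : B * theta ^+ N / (1 - theta) <= e.
  apply: le_trans hN0; rewrite ler_pM2r ?invr_gt0// ler_wpM2l//.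
  by apply: ler_wiXn2l => //; exact: ltW.
have hM M : (N <= M)%N -> `|\sum_(i < M) c i x - \sum_(i < N) c i x| <= e.
  by move=> /subnKC <-; exact: le_trans (tail N _ x Px) hN.
rewrite ler_distl; apply/andP; split.
  apply: (cvgn_ge_from (N0 := N) (cv x Px)) => M /hM.
  by rewrite ler_distl => /andP[].
apply: (cvgn_le_from (N0 := N) (cv x Px)) => M /hM.
by rewrite ler_distl => /andP[].
Qed.

End Series.

(** * Uniform limits, and primitives of functions supported in [[0, 1]] *)

Section Primitive.
Context {R : realType}.
Implicit Types (f F : R -> R).

Lemma uniform_limit_continuous_at (X : topologicalType) (u : nat -> X -> R)
    (l : X -> R) (P : set X) (x : X) : nbhs x P ->
  (forall N, {for x, continuous (u N)}) ->
  (forall e, 0 < e -> exists N0, forall N x, (N0 <= N)%N -> P x -> `|l x - u N x| <= e) ->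
  {for x, continuous l}.
Proof.
move=> Px cu lu; apply/cvgrPdist_le => e e0.
have e30 : 0 < e / 3 by rewrite divr_gt0.
have [N hN] := lu _ e30; have {}hN y := hN N y (leqnn N).
have /cvgrPdist_le /(_ _ e30) cN := cu N.
near=> y.
have Py : P y by near: y.
have h1 := hN _ (nbhs_singleton Px); have h2 := hN _ Py.
have h3 : `|u N x - u N y| <= e / 3 by near: y.
rewrite (_ : l x - l y = (l x - u N x) + (u N x - u N y) - (l y - u N y)); last by ring.
rewrite (le_trans (ler_normB _ _))// (le_trans (lerD (ler_normD _ _) (lexx _)))//.
lra.
Unshelve. all: by end_near. Qed.

(** This is the integral of [f] from [q] to 1, signed when [q > 1]. A base point left of the support
    turns it into one formula valid for every real [q], with no case distinction on orientation. *)
Definition tail_integral f (q : R) : R :=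
  Rintegral lebesgue_measure `[-1, 1] f - Rintegral lebesgue_measure `[-1, q] f.

Lemma tail_integral1 f : tail_integral f 1 = 0.
Proof. by rewrite /tail_integral subrr. Qed.

Lemma is_derive_tail_integral f (q : R) : continuous f -> (forall x, x <= 0 -> f x = 0) ->
  is_derive q 1 (tail_integral f) (- f q).
Proof.
move=> cf f0.
suff dI : is_derive q 1 (fun y => Rintegral lebesgue_measure `[-1, y] f) (f q).
  rewrite -[- f q]add0r.
  exact: is_derive_fun_add (is_derive_fun_cst _ _) (is_deriveN dI).
have [q1|q1] := ltP (-1) q.
  have [||||d1 d2] := @continuous_FTC1_closed R f (-1) q (q + 1).
  - by rewrite ltrDl.
  - apply: continuous_compact_integrable; first exact: segment_compact.
    exact: continuous_subspaceT.
  - exact: q1.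
  - exact: cf.
  apply: DeriveDef; first exact: d1.
  by rewrite -derive1E.
(* The fundamental theorem needs [q] right of the base point. For [q <= -1] the integral is 0 near
   [q], because [f] vanishes left of 0. *)
have q0 : q < 0 by lra.
apply: (@near_eq_is_derive _ _ _ (fun=> 0)); last first.
  by rewrite f0 1?ltW//; exact: is_derive_cst.
near=> y; rewrite (@eq_Rintegral _ _ _ _ _ (cst 0)) ?Rintegral_cst// ?mul0r//.
move=> x; rewrite inE /= in_itv /= => /andP[_ xy]; rewrite f0//.
rewrite (le_trans xy)// ltW//; near: y; exact: lt_nbhsl.
Unshelve. all: by end_near. Qed.

Lemma primitive_eq0_right F f q : (forall x : R, is_derive x 1 F (f x)) -> F 1 = 0 ->
  (forall x, 1 <= x -> f x = 0) -> 1 <= q -> F q = 0.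
Proof.
move=> dF F1 f0 q1; have [c] := MVT_everywhere 1 q dF.
rewrite (min_idPl q1) => /andP[c1 _].
by rewrite f0// F1 mul0r subr0.
Qed.

Lemma primitive_cst_left F f q : (forall x : R, is_derive x 1 F (f x)) ->
  (forall x, x <= 0 -> f x = 0) -> q <= 0 -> F q = F 0.
Proof.
move=> dF f0 q0; have [c] := MVT_everywhere q 0 dF.
rewrite (max_idPr q0) => /andP[_ c0].
by rewrite f0// mul0r => /eqP; rewrite subr_eq0 => /eqP.
Qed.

(** The derivative lives on an interval of length 1, so its bound passes to [F] without a constant:
    mean value theorem on [[q, 1]], and [F] is constant outside [[0, 1]]. *)
Lemma primitive_bound F f M q : (forall x : R, is_derive x 1 F (f x)) -> F 1 = 0 ->
  (forall x, x <= 0 \/ 1 <= x -> f x = 0) -> (forall x, `|f x| <= M) -> `|F q| <= M.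
Proof.
move=> dF F1 f0 fM.
have M0 : 0 <= M by exact: le_trans (fM 0).
have bd y : 0 <= y -> `|F y| <= M.
  move=> y0; have [y1|/ltW y1] := leP 1 y.
    by rewrite (primitive_eq0_right dF F1 _ y1) ?normr0// => x x1; apply: f0; right.
  have [c _] := MVT_everywhere y 1 dF; rewrite F1 sub0r => E.
  rewrite -normrN E normrM [X in _ * X]ger0_norm ?subr_ge0//.
  rewrite -[leRHS]mulr1; apply: ler_pM => //; lra.
have [q0|/ltW q0] := leP 0 q; first exact: bd.
rewrite (primitive_cst_left dF _ q0) ?bd// => x x0; by apply: f0; left.
Qed.

Lemma primitive_ge0 F f q : (forall x : R, is_derive x 1 F (f x)) -> F 1 = 0 ->
  (forall x, 1 <= x -> f x = 0) -> (forall x, f x <= 0) -> 0 <= F q.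
Proof.
move=> dF F1 f0 fle; have [q1|/ltW q1] := leP 1 q.
  by rewrite (primitive_eq0_right dF F1 f0 q1).
have [c _] := MVT_everywhere q 1 dF; rewrite F1 sub0r => E.
rewrite -oppr_le0 E mulr_le0_ge0 ?subr_ge0//.
Qed.

End Primitive.

(** * Taylor coefficients of the solution for one angle *)

(** The normalisation [a <= 1] with support in [[0, 1]] gives [V <= sup K] with constant 1. The
    lower bound on a small interval is what forces blow-up in finite time. *)
Record profile {R : realType} (a : R -> R) : Prop := Profile {
  profile_continuous : continuous a;
  profile_ge0 : forall q, 0 <= a q;
  profile_le1 : forall q, a q <= 1;
  profile_out : forall q : R, q <= 0 \/ 1 <= q -> a q = 0;
  profile_pos : exists p r c : R,
    [/\ p < r, 0 < c & forall q, p <= q <= r -> c <= a q] }.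

Section Coefficients.
Context {R : realType} (a : R -> R).

(* [coef_upto n i] is the [i]-th Taylor coefficient for [i <= n]. *)
Fixpoint coef_upto (n : nat) : nat -> R -> R :=
  if n is m.+1 then
    let k := coef_upto m in
    fun i => if i == m.+1 then
      fun q => m.+1%:R^-1 * \sum_(j < m.+1)
        a q * k j q * tail_integral (fun x => a x * k (m - j)%N x) q
    else k i
  else fun _ _ => 1.

Definition Kcoef n := coef_upto n n.
Definition Vcoef n := tail_integral (fun x => a x * Kcoef n x).

Lemma coef_upto_le n i : (i <= n)%N -> coef_upto n i = Kcoef i.
Proof.
elim: n => [|n IH]; first by rewrite leqn0 => /eqP ->.
rewrite leq_eqVlt => /predU1P[->//|]; rewrite ltnS => lein.
by rewrite /= ltn_eqF ?ltnS// IH.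
Qed.

Lemma Kcoef0 q : Kcoef 0 q = 1. Proof. by []. Qed.

(** Coefficient of [t ^ n] in [K_t = a K V]; the product [K V] contributes the convolution. *)
Lemma KcoefS n q :
  Kcoef n.+1 q = n.+1%:R^-1 * \sum_(j < n.+1) a q * Kcoef j q * Vcoef (n - j) q.
Proof.
rewrite /Kcoef /= eqxx; congr (_ * _); apply: eq_bigr => j _.
rewrite coef_upto_le -1?ltnS// /Vcoef; congr (_ * tail_integral _ q).
by apply/funext => x; rewrite coef_upto_le ?leq_subr.
Qed.

Lemma mulSKcoef n q :
  n.+1%:R * Kcoef n.+1 q = \sum_(j < n.+1) a q * Kcoef j q * Vcoef (n - j) q.
Proof. by rewrite KcoefS mulrA mulfV ?mul1r// pnatr_eq0. Qed.

Context (ha : profile a).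

Let a_cont := profile_continuous ha.
Let a_ge0 := profile_ge0 ha.
Let a_le1 := profile_le1 ha.
Let a_out := profile_out ha.
Let prop n := continuous (Kcoef n) /\ (forall q, 0 <= Kcoef n q <= 1).

Lemma is_derive_Vcoef_of n (q : R) : continuous (Kcoef n) ->
  is_derive q 1 (Vcoef n) (- (a q * Kcoef n q)).
Proof.
move=> ck; apply: is_derive_tail_integral.
  by move=> x; apply: continuousM; [exact: a_cont|exact: ck].
by move=> x x0; rewrite a_out ?mul0r//; left.
Qed.

Lemma Vcoef_bound_of n q : prop n -> 0 <= Vcoef n q <= 1.
Proof.
move=> [ck k01].
have dV x := @is_derive_Vcoef_of n x ck.
have out x : x <= 0 \/ 1 <= x -> - (a x * Kcoef n x) = 0.
  by move=> /a_out ->; rewrite mul0r oppr0.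
apply/andP; split.
  apply: (primitive_ge0 _ dV (tail_integral1 _)).
    by move=> x x1; apply: out; right.
  by move=> x; rewrite oppr_le0 mulr_ge0//; case/andP: (k01 x).
apply: le_trans (ler_norm _) _.
apply: (primitive_bound _ dV (tail_integral1 _) out) => x.
have /andP[? ?] := k01 x.
by rewrite normrN normrM !ger0_norm// mulr_ile1.
Qed.

(** The recursion expresses the next coefficient as a mean of [n.+1] products of numbers in
    [[0, 1]]. Continuity is carried along in the induction because differentiating [Vcoef] requires
    it. *)
Lemma Kcoef_prop n : prop n.
Proof.
elim/ltn_ind: n => -[|n] IH.
  split; first by move=> q; exact: cvg_cst.
  by move=> q; rewrite Kcoef0 ler01 lexx.
have IH' j : (j <= n)%N -> prop j by move=> jn; exact: IH.
split.
  rewrite (_ : Kcoef n.+1 = fun q => n.+1%:R^-1 *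
      \sum_(j < n.+1) a q * Kcoef j q * Vcoef (n - j) q); last first.
    by apply/funext => q; rewrite KcoefS.
  move=> q; apply: (@continuousM _ _ (fun=> n.+1%:R^-1)); first exact: cvg_cst.
  apply: continuous_fun_sum => j; have jn : (j <= n)%N by rewrite -ltnS.
  apply: continuousM.
    by apply: continuousM; [exact: a_cont|have [ck _] := IH' _ jn; exact: ck].
  have [ck _] := IH' _ (leq_subr j n).
  exact: is_derive_continuous (is_derive_Vcoef_of _ ck).
move=> q.
have h (j : 'I_n.+1) : 0 <= a q * Kcoef j q * Vcoef (n - j) q <= 1.
  have [_ /(_ q) /andP[k0 k1]] : prop j by apply: IH'; rewrite -ltnS.
  have /andP[v0 v1] := Vcoef_bound_of q (IH' _ (leq_subr j n)).
  by rewrite !mulr_ge0// !mulr_ile1// mulr_ge0.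
rewrite KcoefS; apply/andP; split.
  by rewrite mulr_ge0// ?invr_ge0// sumr_ge0// => j _; case/andP: (h j).
rewrite mulrC ler_pdivrMr ?ltr0n// mul1r.
have -> : n.+1%:R = \sum_(j < n.+1) (1 : R) by rewrite sumr_const card_ord.
by apply: ler_sum => j _; case/andP: (h j).
Qed.

Lemma Kcoef_continuous n : continuous (Kcoef n).
Proof. by case: (Kcoef_prop n). Qed.

Lemma Kcoef_ge0 n q : 0 <= Kcoef n q.
Proof. by case: (Kcoef_prop n) => _ /(_ q) /andP[]. Qed.

Lemma is_derive_Vcoef n (q : R) : is_derive q 1 (Vcoef n) (- (a q * Kcoef n q)).
Proof. exact/is_derive_Vcoef_of/Kcoef_continuous. Qed.

Lemma Vcoef_continuous n : continuous (Vcoef n).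
Proof. by move=> q; exact: is_derive_continuous (is_derive_Vcoef n q). Qed.

Lemma Vcoef_ge0 n q : 0 <= Vcoef n q.
Proof. by case/andP: (Vcoef_bound_of q (Kcoef_prop n)). Qed.

Lemma Vcoef1 n : Vcoef n 1 = 0.
Proof. exact: tail_integral1. Qed.

(* The lower bounds are the Taylor coefficients of
   [(1 - c ^ 2 (r - q) t / 2) ^ (-2)], the solution for [a = c] on [[p, r]]. *)
Lemma Kcoef_lower_bound (p r c : R) n (q : R) : 0 <= c -> (forall x, p <= x <= r -> c <= a x) ->
  p <= q <= r -> n.+1%:R * (c ^+ 2 / 2 * (r - q)) ^+ n <= Kcoef n q.
Proof.
move=> c0 ca; elim/ltn_ind: n q => -[|n] IH q pqr; first by rewrite expr0 mulr1 Kcoef0.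
have {}IH j x : (j <= n)%N -> p <= x <= r ->
  j.+1%:R * (c ^+ 2 / 2 * (r - x)) ^+ j <= Kcoef j x by move=> jn; exact: IH.
set d := c ^+ 2 / 2 in IH *.
have d0 : 0 <= d by rewrite divr_ge0// sqr_ge0.
(* The bound on [Kcoef j] is integrated from [q] to [r]. Instead of comparing integrals, the
   difference [F] is shown to be nonincreasing up to [r], where it is nonnegative. *)
have V j : (j <= n)%N -> c * (d ^+ j * (r - q) ^+ j.+1) <= Vcoef j q.
  move=> jn; have /andP[pq qr] := pqr.
  pose F x := Vcoef j x - c * (d ^+ j * (r - x) ^+ j.+1).
  pose dF x := - (a x * Kcoef j x) + c * (d ^+ j * (j.+1%:R * (r - x) ^+ j)).
  have dFE (x : R) : is_derive x 1 F (dF x).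
    apply: is_derive_fun_add; first exact: is_derive_Vcoef.
    have d1 : is_derive x 1 (fun y : R => r - y) (-1).
      rewrite -[-1]add0r.
      exact: is_derive_fun_add (is_derive_fun_cst r x) (is_deriveNid _ _).
    have d2 := is_derive_fun_mul (is_derive_fun_cst (- (c * d ^+ j)) x)
                 (is_derive_fun_pow j.+1 d1).
    rewrite (_ : (fun y => - _) = fun y => - (c * d ^+ j) * (r - y) ^+ j.+1); last first.
      by apply/funext => y; ring.
    by apply: is_derive_eq d2 _; rewrite /=; ring.
  have [x] := MVT_everywhere q r dFE.
  rewrite (min_idPl qr) (max_idPr qr) => /andP[qx xr] E.
  have dFx : dF x <= 0.
    have px : p <= x <= r by rewrite (le_trans pq)//.
    have := IH j x jn px; rewrite exprMn => hk.
    rewrite /dF addrC subr_le0.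
    have : c * (j.+1%:R * (d ^+ j * (r - x) ^+ j)) <= a x * Kcoef j x.
      by apply: ler_pM => //; [rewrite !mulr_ge0// exprn_ge0// subr_ge0|exact: ca].
    by apply: le_trans; rewrite le_eqVlt; apply/orP; left; apply/eqP; ring.
  have Fr : 0 <= F r by rewrite /F subrr expr0n /= !mulr0 subr0 Vcoef_ge0.
  have : dF x * (r - q) <= 0 by rewrite mulr_le0_ge0// subr_ge0.
  by rewrite -E; move: Fr; rewrite /F; lra.
rewrite KcoefS [leRHS]mulrC ler_pdivlMr ?ltr0n//.
have /andP[pq qr] := pqr; have rq0 : 0 <= r - q by rewrite subr_ge0.
(* The powers in the convolution do not depend on [j], and the weights add up to [(n+1)(n+2)/2]. The
   denominator 2 is absorbed by [d = c ^ 2 / 2]. *)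
apply: (@le_trans _ _ (\sum_(j < n.+1) c * (j.+1%:R * (d * (r - q)) ^+ j) *
    (c * (d ^+ (n - j) * (r - q) ^+ (n - j).+1)))).
  have -> : \sum_(j < n.+1) c * (j.+1%:R * (d * (r - q)) ^+ j) *
    (c * (d ^+ (n - j) * (r - q) ^+ (n - j).+1)) =
    (\sum_(j < n.+1) j.+1%:R) * (c ^+ 2 * d ^+ n * (r - q) ^+ n.+1).
    rewrite mulr_suml; apply: eq_bigr => j _.
    have jn : (j <= n)%N by rewrite -ltnS.
    have -> : d ^+ n = d ^+ j * d ^+ (n - j) by rewrite -exprD subnKC.
    have -> : (r - q) ^+ n.+1 = (r - q) ^+ j * (r - q) ^+ (n - j).+1.
      by rewrite -exprD addnS subnKC.
    by rewrite exprMn; ring.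
  have -> : \sum_(j < n.+1) j.+1%:R = n.+1%:R * n.+2%:R / 2 :> R.
    elim: n {IH V} => [|n IHn]; first by rewrite big_ord1 /=; field.
    by rewrite big_ord_recr /= IHn -(natr1 n.+2) -!(natr1 n.+1); field.
  rewrite le_eqVlt; apply/orP; left; apply/eqP.
  by rewrite exprMn exprS /d; field.
apply: ler_sum => j _; have jn : (j <= n)%N by rewrite -ltnS.
apply: ler_pM; last by apply: V; exact: leq_subr.
- by rewrite !mulr_ge0// exprn_ge0// mulr_ge0.
- by rewrite !mulr_ge0// exprn_ge0.
- apply: ler_pM => //; [|exact: ca|exact: IH].
  by rewrite !mulr_ge0// exprn_ge0// mulr_ge0.
Qed.

End Coefficients.

(** * Partial sums of the series and the time of blow-up *)

Section PartialSums.
Context {R : realType} (a : R -> R) (ha : profile a).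
Implicit Types (x y t h q B : R) (N n : nat).

Let k_ge0 := Kcoef_ge0 ha.
Let v_ge0 := Vcoef_ge0 ha.

Definition Ksum N t q := \sum_(i < N) Kcoef a i q * t ^+ i.
Definition Vsum N t q := \sum_(i < N) Vcoef a i q * t ^+ i.
(** The derivative in [t] of [Ksum N.+1], not of [Ksum N]: the constant term drops out. *)
Definition dKsum N t q := \sum_(i < N) i.+1%:R * Kcoef a i.+1 q * t ^+ i.

Lemma Ksum_ge0 N t q : 0 <= t -> 0 <= Ksum N t q.
Proof. by move=> t0; apply: sumr_ge0 => i _; rewrite mulr_ge0// exprn_ge0. Qed.

Lemma Vsum_ge0 N t q : 0 <= t -> 0 <= Vsum N t q.
Proof. by move=> t0; apply: sumr_ge0 => i _; rewrite mulr_ge0// exprn_ge0. Qed.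

Lemma Ksum0 N q : Ksum N 0 q = (0 < N)%:R.
Proof.
case: N => [|N]; first by rewrite /Ksum big_ord0.
rewrite /Ksum big_ord_recl /= expr0 mulr1 big1 ?addr0// => i _.
by rewrite exprS mul0r mulr0.
Qed.

Lemma Ksum_homo N x y q : 0 <= x -> x <= y -> Ksum N x q <= Ksum N y q.
Proof.
move=> x0 xy; apply: ler_sum => i _; rewrite ler_wpM2l//.
by apply: lerXn2r => //; rewrite nnegrE// (le_trans x0).
Qed.

Lemma is_derive_Vsum N t q :
  is_derive q 1 (Vsum N t) (- (a q * Ksum N t q)).
Proof.
rewrite (_ : - _ = \sum_(i < N) (- (a q * Kcoef a i q) * t ^+ i)); last first.
  by rewrite mulr_sumr -sumrN; apply: eq_bigr => i _; ring.
apply: (@is_derive_fun_sum _ (fun i q => Vcoef a i q * t ^+ i)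
  (fun i => - (a q * Kcoef a i q) * t ^+ i)) => i.
apply: is_derive_eq (is_derive_fun_mul (is_derive_Vcoef ha i q) (is_derive_fun_cst (t ^+ i) q)) _.
by rewrite mulr0 addr0.
Qed.

Lemma Vsum1 N t : Vsum N t 1 = 0.
Proof. by apply: big1 => i _; rewrite Vcoef1 mul0r. Qed.

Lemma Vsum_le N t B q : 0 <= t -> (forall q, Ksum N t q <= B) -> Vsum N t q <= B.
Proof.
move=> t0 hB; apply: le_trans (ler_norm _) _.
have dV x := is_derive_Vsum N t x.
have out x : x <= 0 \/ 1 <= x -> - (a x * Ksum N t x) = 0.
  by move=> /(profile_out ha) ->; rewrite mul0r oppr0.
apply: (primitive_bound _ dV (Vsum1 N t) out) => x.
 have K0 := Ksum_ge0 N x t0; rewrite normrN ger0_norm.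
  by rewrite -[B]mul1r; apply: ler_pM => //; [exact: profile_ge0|exact: profile_le1].
by rewrite mulr_ge0//; exact: profile_ge0.
Qed.

Lemma dKsumE N t q : dKsum N t q = a q * \sum_(n < N) \sum_(i < n.+1)
  (Kcoef a i q * t ^+ i) * (Vcoef a (n - i) q * t ^+ (n - i)).
Proof.
rewrite mulr_sumr; apply: eq_bigr => n _.
rewrite mulSKcoef mulr_suml mulr_sumr; apply: eq_bigr => i _.
have -> : t ^+ n = t ^+ i * t ^+ (n - i) by rewrite -exprD subnKC// -ltnS.
by ring.
Qed.

(** Truncating [K_t = a K V] discards nonnegative terms of the product. The index shift lets order
    [N] control the growth of order [N.+1]. *)
Lemma dKsum_le N t q : 0 <= t -> dKsum N t q <= a q * (Ksum N t q * Vsum N t q).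
Proof.
move=> t0; rewrite dKsumE ler_wpM2l ?(profile_ge0 ha)//.
apply: (@cauchy_product_le _ (fun i => Kcoef a i q * t ^+ i)
  (fun i => Vcoef a i q * t ^+ i)) => i; by rewrite mulr_ge0// exprn_ge0.
Qed.

Lemma dKsum_ge N t q : 0 <= t ->
  a q * (Ksum N t q * Vsum N t q) <= dKsum (N + N) t q.
Proof.
move=> t0; rewrite dKsumE ler_wpM2l ?(profile_ge0 ha)//.
apply: (@cauchy_product_ge _ (fun i => Kcoef a i q * t ^+ i)
  (fun i => Vcoef a i q * t ^+ i)) => i; by rewrite mulr_ge0// exprn_ge0.
Qed.

Lemma subrX_bounds n x y : 0 <= x <= y ->
  (y - x) * (n.+1%:R * x ^+ n) <= y ^+ n.+1 - x ^+ n.+1 <= (y - x) * (n.+1%:R * y ^+ n).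
Proof.
move=> /andP[x0 xy]; have y0 := le_trans x0 xy.
have cst (z : R) : n.+1%:R * z ^+ n = \sum_(i < n.+1) z ^+ (n - i) * z ^+ i.
  under eq_bigr => i _ do rewrite -exprD subnK -1?ltnS//.
  by rewrite sumr_const card_ord mulr_natl.
rewrite subrXX /= !cst !ler_wpM2l ?subr_ge0//; apply: ler_sum => i _.
- by apply: ler_wpM2l; rewrite ?exprn_ge0//; apply: lerXn2r.
- by apply: ler_wpM2r; rewrite ?exprn_ge0//; apply: lerXn2r.
Qed.

(** Convexity in time on the nonnegative half-line: an increment lies between the slopes at the two
    ends. These inequalities survive the limit in [N], so no termwise differentiation is needed
    later. *)
Lemma Ksum_increment N x y q : 0 <= x <= y ->
  (y - x) * dKsum N x q <= Ksum N.+1 y q - Ksum N.+1 x q <= (y - x) * dKsum N y q.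
Proof.
move=> xy; rewrite /Ksum !big_ord_recl /= !expr0 opprD addrACA subrr add0r -sumrB.
rewrite /dKsum !mulr_sumr; apply/andP; split; apply: ler_sum => i _;
  rewrite -mulrBr /bump /= add1n; have /andP[h1 h2] := subrX_bounds i xy.
- have := ler_wpM2l (k_ge0 i.+1 q) h1; apply: le_trans.
  by rewrite le_eqVlt; apply/orP; left; apply/eqP; ring.
- have := ler_wpM2l (k_ge0 i.+1 q) h2; move=> h; apply: (le_trans h).
  by rewrite le_eqVlt; apply/orP; left; apply/eqP; ring.
Qed.

(** Induction on [N] takes the place of a continuity argument in time. If order [N] is at most [2 B]
    at time [x + h], then order [N.+1] is at most [B + h (2 B) ^ 2], and [4 B h <= 1] makes this at
    most [2 B]. *)
Lemma Ksum_continuation x B h N q : 0 <= x -> 0 <= B ->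
  (forall N q, Ksum N x q <= B) -> 0 <= h -> 4 * B * h <= 1 ->
  Ksum N (x + h) q <= 2 * B.
Proof.
move=> x0 B0 hB h0 Bh; elim: N q => [|N IH] q.
  by rewrite /Ksum big_ord0 mulr_ge0.
have xh : 0 <= x <= x + h by rewrite x0 lerDl.
have xh0 : 0 <= x + h by rewrite addr_ge0.
have /andP[_] := Ksum_increment N q xh.
rewrite (addrC x) addrK (addrC h) => h1.
have h2 : dKsum N (x + h) q <= 2 * B * (2 * B).
  apply: le_trans (dKsum_le _ _ xh0) _.
  rewrite -[leRHS]mul1r; apply: ler_pM.
  - exact: profile_ge0.
  - by rewrite mulr_ge0 ?Ksum_ge0 ?Vsum_ge0.
  - exact: profile_le1.
  - by apply: ler_pM; rewrite ?Ksum_ge0 ?Vsum_ge0// Vsum_le.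
have h3 := ler_wpM2l h0 h2; have h4 := hB N.+1 q.
have h5 : h * (2 * B * (2 * B)) <= B.
  have := ler_wpM2l B0 Bh; rewrite mulr1; apply: le_trans.
  by rewrite le_eqVlt; apply/orP; left; apply/eqP; ring.
lra.
Qed.

Definition Kbounded : set R :=
  [set t | 0 <= t /\ exists B, 1 <= B /\ forall N q, Ksum N t q <= B].

Definition lifespan := sup Kbounded.

Lemma Kbounded0 : Kbounded 0.
Proof.
by split=> //; exists 1; split=> // N q; rewrite Ksum0 lern1 leq_b1.
Qed.

Lemma Kbounded_downward x y : 0 <= x -> x <= y -> Kbounded y -> Kbounded x.
Proof.
move=> x0 xy [_ [B [B1 hB]]]; split=> //; exists B; split=> // N q.
exact: le_trans (Ksum_homo _ _ x0 xy) (hB N q).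
Qed.

Lemma Kbounded_continuation x B h : 0 <= x -> 1 <= B ->
  (forall N q, Ksum N x q <= B) -> 0 <= h -> 4 * B * h <= 1 -> Kbounded (x + h).
Proof.
move=> x0 B1 hB h0 Bh; have B0 := le_trans ler01 B1.
split; first exact: addr_ge0.
exists (2 * B); split; first lra.
by move=> N q; exact: Ksum_continuation.
Qed.

(** At [q = p] the [i]-th term is at least [(d t) ^ i], which is at least 1 once [t > 1 / d], so the
    sums exceed every bound. The time [1 / d] is the one at which the comparison solution blows up
    at [p]. *)
Lemma Kbounded_has_sup : has_sup Kbounded.
Proof.
split; first by exists 0; exact: Kbounded0.
have [p [r [c [pr c0 ca]]]] := profile_pos ha.
have d0 : 0 < c ^+ 2 / 2 * (r - p) by rewrite mulr_gt0 ?subr_gt0// divr_gt0// exprn_gt0.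
set d := c ^+ 2 / 2 * (r - p) in d0.
exists d^-1 => t [t0 [B [_ hB]]]; rewrite leNgt; apply/negP => td.
have h N : N%:R <= B.
  apply: le_trans (hB N p).
  have -> : N%:R = \sum_(i < N) (1 : R) by rewrite sumr_const card_ord.
  apply: ler_sum => i _.
  have /= hk := @Kcoef_lower_bound _ _ ha p r c i p (ltW c0) ca.
  have {}hk : i.+1%:R * d ^+ i <= Kcoef a i p by apply: hk; rewrite lexx ltW.
  apply: (@le_trans _ _ (1 * d ^+ i * t ^+ i)).
    rewrite mul1r -exprMn exprn_ege1// mulrC -ler_pdivrMr// div1r.
    exact: ltW.
  rewrite ler_wpM2r ?exprn_ge0//; apply: le_trans hk.
  by apply: ler_wpM2r; [apply: exprn_ge0; exact: ltW|rewrite ler1n].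
have := archi_boundP (le_trans (ler0n R 0) (h 0%N)).
by rewrite ltNge h.
Qed.

Lemma lifespan_gt0 : 0 < lifespan.
Proof.
apply: (@lt_le_trans _ _ 4^-1); first by rewrite invr_gt0.
apply: ub_le_sup; first by case: Kbounded_has_sup.
rewrite -[4^-1]add0r; apply: (@Kbounded_continuation _ 1) => //.
- by move=> N q; rewrite Ksum0 lern1 leq_b1.
- by rewrite mulr1 mulfV.
Qed.

Lemma Kbounded_lt_lifespan t : 0 <= t < lifespan -> Kbounded t.
Proof.
move=> /andP[t0 tT].
have e0 : 0 < lifespan - t by rewrite subr_gt0.
have [y Ey ty] := sup_adherent e0 Kbounded_has_sup.
apply: Kbounded_downward Ey => //; apply: ltW; move: ty.
by rewrite /lifespan opprB addrCA subrr addr0.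
Qed.

Lemma Ksum_unbounded B : exists t N q, 0 <= t < lifespan /\ B < Ksum N t q.
Proof.
apply: contrapT => hn; have T0 := lifespan_gt0.
pose C := Num.max 1 B.
have C1 : 1 <= C by rewrite le_max lexx.
have hC t N q : 0 <= t < lifespan -> Ksum N t q <= C.
  move=> ht; rewrite le_max; apply/orP; right; rewrite leNgt; apply/negP => hlt.
  by apply: hn; exists t, N, q.
have C0 : 0 < C by apply: lt_le_trans C1.
(* A starting time at distance at most [1 / (8 C)] from the supremum, so that one continuation step,
   of length [1 / (4 C)], goes past it. *)
pose t := Num.max 0 (lifespan - (8 * C)^-1).
have C8 : 0 < (8 * C)^-1 by rewrite invr_gt0 mulr_gt0.
have t0 : 0 <= t by rewrite le_max lexx.
have tT : t < lifespan by rewrite gt_max T0 gtrBl.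
have hE : Kbounded (t + (4 * C)^-1).
  apply: (@Kbounded_continuation _ C) => //.
  - by move=> N q; apply: hC; rewrite t0.
  - by rewrite invr_ge0 mulr_ge0// ltW.
  - by rewrite mulfV// gt_eqF// mulr_gt0.
have : t + (4 * C)^-1 <= lifespan.
  by apply: ub_le_sup hE; case: Kbounded_has_sup.
have : lifespan - (8 * C)^-1 <= t by rewrite le_max lexx orbT.
have -> : (4 * C)^-1 = 2 * (8 * C)^-1 by field; rewrite gt_eqF.
lra.
Qed.

End PartialSums.

(** * The limit functions [K] and [V]: equations and blow-up *)

Section ModelSolution.
Context {R : realType} (a : R -> R) (ha : profile a).
Implicit Types (x y t h q B : R) (N n : nat).

Definition Kfun t q := limn (fun N => Ksum a N t q).
Definition Vfun t q := limn (fun N => Vsum a N t q).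

Let T := lifespan a.

(** Abel's lemma, uniformly in [q]: at a time [r] between [|t|] and [T] each nonnegative term is at
    most the bound on the sums, which gives the ratio [s / r] for times up to [s < r]. Negative
    times are included so that 0 is an interior point. *)
Lemma coef_geometric t : `|t| < T -> exists rho B theta,
  [/\ `|t| < rho, 0 <= B, 0 <= theta < 1 &
    forall n y q, `|y| < rho -> `|Kcoef a n q * y ^+ n| <= B * theta ^+ n /\
                                `|Vcoef a n q * y ^+ n| <= B * theta ^+ n].
Proof.
move=> tT; have T0 := lifespan_gt0 ha; have t0 := normr_ge0 t.
pose r := (`|t| + T) / 2; pose s := (`|t| + r) / 2.
have tr : `|t| < r by rewrite /r; lra.
have rT : r < T by rewrite /r; lra.
have ts : `|t| < s by rewrite /s; lra.
have sr : s < r by rewrite /s; lra.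
have r0 : 0 < r by lra.
have s0 : 0 < s by lra.
clearbody s r.
have [|_ [B [B1 hB]]] := @Kbounded_lt_lifespan _ _ ha r; first by rewrite rT ltW.
have term (c : nat -> R) : (forall i, 0 <= c i) ->
    (forall N, \sum_(i < N) c i * r ^+ i <= B) -> forall n y, `|y| < s ->
    `|c n * y ^+ n| <= B * (s / r) ^+ n.
  move=> c0 cB n y ys; rewrite normrM (ger0_norm (c0 n)) normrX.
  have ry : `|y| ^+ n <= s ^+ n by apply: lerXn2r; rewrite ?nnegrE// ltW.
  apply: (le_trans (ler_wpM2l (c0 n) ry)).
  have h : c n * r ^+ n <= B.
    apply: le_trans (cB n.+1); rewrite big_ord_recr /= lerDr.
    by apply: sumr_ge0 => i _; rewrite mulr_ge0// exprn_ge0// ltW.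
  rewrite expr_div_n mulrA ler_pdivlMr ?exprn_gt0//.
  by rewrite mulrAC ler_wpM2r// exprn_ge0// ltW.
exists s, B, (s / r); split=> //; first by rewrite (le_trans ler01).
  by rewrite divr_ge0 ?ltW//= ltr_pdivrMr// mul1r.
move=> n y q ys; split.
- apply: (term (fun i => Kcoef a i q)) => // [i|N]; first exact: Kcoef_ge0.
  exact: hB.
- apply: (term (fun i => Vcoef a i q)) => // [i|N]; first exact: Vcoef_ge0.
  by apply: Vsum_le => //; exact: ltW.
Qed.

Lemma model_locally_uniform t : `|t| < T -> exists2 rho, `|t| < rho &
  [/\ forall y q, `|y| < rho -> Ksum a N y q @[N --> \oo] --> Kfun y q,
      forall y q, `|y| < rho -> Vsum a N y q @[N --> \oo] --> Vfun y q &
      forall e, 0 < e -> exists N0, forall N y q, (N0 <= N)%N -> `|y| < rho ->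
        `|Kfun y q - Ksum a N y q| <= e /\ `|Vfun y q - Vsum a N y q| <= e].
Proof.
move=> /coef_geometric [rho [B [th [trho B0 th01 hB]]]].
pose P := [set x : R * R | `|x.1| < rho].
have [K1 K2] := @geometric_tail _ _ P (fun n z => Kcoef a n z.2 * z.1 ^+ n) B th
  B0 th01 (fun n z Pz => (hB n z.1 z.2 Pz).1).
have [V1 V2] := @geometric_tail _ _ P (fun n z => Vcoef a n z.2 * z.1 ^+ n) B th
  B0 th01 (fun n z Pz => (hB n z.1 z.2 Pz).2).
exists rho => //; split.
- by move=> y q yr; exact: (K1 (y, q)).
- by move=> y q yr; exact: (V1 (y, q)).
- move=> e e0; have [M hM] := K2 e e0; have [N hN] := V2 e e0.
  exists (maxn M N) => n y q; rewrite geq_max => /andP[Mn Nn] yr.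
  by split; [exact: (hM n (y, q))|exact: (hN n (y, q))].
Qed.

Lemma Ksum_cvg t q : `|t| < T -> Ksum a N t q @[N --> \oo] --> Kfun t q.
Proof. by move=> /model_locally_uniform [rho tr [h _ _]]; exact: h. Qed.

Lemma Vsum_cvg t q : `|t| < T -> Vsum a N t q @[N --> \oo] --> Vfun t q.
Proof. by move=> /model_locally_uniform [rho tr [_ h _]]; exact: h. Qed.

Lemma model_continuous_aux t q : `|t| < T ->
  {for (t, q), continuous (fun x : R * R => Kfun x.1 x.2)} /\
  {for (t, q), continuous (fun x : R * R => Vfun x.1 x.2)}.
Proof.
move=> /model_locally_uniform [rho tr [_ _ h]].
pose P := [set x : R * R | `|x.1| < rho].
have nP : nbhs (t, q) P.
  have c : {for (t, q), continuous (fun x : R * R => `|x.1|)}.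
    by apply: (@continuous_comp _ _ _ fst (fun y : R => `|y|)); [exact: cvg_fst|exact: norm_continuous].
  by move/cvgr_lt : (c) => /(_ _ tr).
have cX n : {for (t, q), continuous (fun x : R * R => x.1 ^+ n)}.
  by apply: (@continuous_comp _ _ _ fst (fun y : R => y ^+ n));
    [exact: cvg_fst|exact: exprn_continuous].
split.
- apply: (@uniform_limit_continuous_at _ _ (fun N z => Ksum a N z.1 z.2) _ P) => //.
    move=> N; apply: (@continuous_fun_sum R (R * R)%type _ _
      (fun (i : 'I_N) z => Kcoef a i z.2 * z.1 ^+ i)) => i.
    apply: continuousM; last exact: cX.
    by apply: (@continuous_comp _ _ _ snd (Kcoef a i));
      [exact: cvg_snd|exact: Kcoef_continuous].
  move=> e e0; have [N0 hN] := h e e0; exists N0 => N z NN Pz.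
  by have [] := hN N z.1 z.2 NN Pz.
- apply: (@uniform_limit_continuous_at _ _ (fun N z => Vsum a N z.1 z.2) _ P) => //.
    move=> N; apply: (@continuous_fun_sum R (R * R)%type _ _
      (fun (i : 'I_N) z => Vcoef a i z.2 * z.1 ^+ i)) => i.
    apply: continuousM; last exact: cX.
    by apply: (@continuous_comp _ _ _ snd (Vcoef a i));
      [exact: cvg_snd|exact: Vcoef_continuous].
  move=> e e0; have [N0 hN] := h e e0; exists N0 => N z NN Pz.
  by have [] := hN N z.1 z.2 NN Pz.
Qed.

Lemma Kfun_continuous t q : `|t| < T ->
  {for (t, q), continuous (fun x : R * R => Kfun x.1 x.2)}.
Proof. by move=> tT; case: (model_continuous_aux q tT). Qed.

Lemma Vfun_continuous t q : `|t| < T ->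
  {for (t, q), continuous (fun x : R * R => Vfun x.1 x.2)}.
Proof. by move=> tT; case: (model_continuous_aux q tT). Qed.

Lemma continuous_pair (X Y Z : topologicalType) (f : X -> Y) (g : X -> Z) (z : X) :
  {for z, continuous f} -> {for z, continuous g} ->
  {for z, continuous (fun w => (f w, g w))}.
Proof. by move=> cf cg; exact: (cvg_pair cf cg). Qed.

Lemma continuous_slice_snd (f : R -> R -> R) t q :
  {for (t, q), continuous (fun x : R * R => f x.1 x.2)} -> {for q, continuous (f t)}.
Proof.
move=> cf; apply: (@continuous_comp _ _ _ (fun y : R => (t, y)) (fun z => f z.1 z.2)) => //.
by apply: continuous_pair; [exact: cvg_cst|exact: cvg_id].
Qed.

Lemma continuous_slice_fst (f : R -> R -> R) t q :
  {for (t, q), continuous (fun x : R * R => f x.1 x.2)} -> {for t, continuous (f^~ q)}.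
Proof.
move=> cf; apply: (@continuous_comp _ _ _ (fun y : R => (y, q)) (fun z => f z.1 z.2)) => //.
by apply: continuous_pair; [exact: cvg_id|exact: cvg_cst].
Qed.

(** The integral and the limit are exchanged through derivatives: the integral of [a K] minus
    [Vsum N] has derivative [- a (K - Ksum N)], uniformly small, and [primitive_bound] transfers the
    smallness. *)
Lemma VfunE t q : `|t| < T -> Vfun t q = tail_integral (fun x => a x * Kfun t x) q.
Proof.
move=> tT; pose F := tail_integral (fun x => a x * Kfun t x).
have dF y : is_derive y 1 F (- (a y * Kfun t y)).
  apply: is_derive_tail_integral; last first.
    by move=> x x0; rewrite (profile_out ha) ?mul0r//; left.
  move=> x; apply: continuousM; first exact: profile_continuous.
  exact/continuous_slice_snd/Kfun_continuous.
have [rho tr [_ _ h]] := model_locally_uniform tT.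
apply/eqP; rewrite -subr_eq0 -normr_le0; apply/ler_addgt0Pr => e e0; rewrite add0r.
have e20 : 0 < e / 2 by rewrite divr_gt0.
have [N hN] := h _ e20; have {}hN y := hN N t y (leqnn N) tr.
have dG y : is_derive y 1 (fun z => F z - Vsum a N t z)
    (- (a y * (Kfun t y - Ksum a N t y))).
  rewrite (_ : - _ = - (a y * Kfun t y) + (- - (a y * Ksum a N t y))); last by ring.
  exact: is_derive_fun_add (dF y) (is_deriveN (is_derive_Vsum ha N t y)).
have : `|F q - Vsum a N t q| <= e / 2.
  apply: (primitive_bound _ dG).
  - by rewrite /F tail_integral1 Vsum1 subrr.
  - by move=> x /(profile_out ha) ->; rewrite mul0r oppr0.
  - move=> x; rewrite normrN normrM ger0_norm ?profile_ge0//.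
    rewrite -[leRHS]mul1r; apply: ler_pM => //; first exact: profile_ge0.
    + exact: profile_le1.
    + by have [] := hN x.
have [_ h2] := hN q => h1; rewrite -/F.
rewrite (_ : Vfun t q - F q = (Vfun t q - Vsum a N t q) - (F q - Vsum a N t q)); last by ring.
by rewrite (le_trans (ler_normB _ _))//; lra.
Qed.

Lemma is_derive_Vfun t q : `|t| < T -> is_derive q 1 (Vfun t) (- (a q * Kfun t q)).
Proof.
move=> tT; rewrite (_ : Vfun t = tail_integral (fun x => a x * Kfun t x)); last first.
  by apply/funext => y; exact: VfunE.
apply: is_derive_tail_integral; last first.
  by move=> x x0; rewrite (profile_out ha) ?mul0r//; left.
move=> x; apply: continuousM; first exact: profile_continuous.
exact/continuous_slice_snd/Kfun_continuous.
Qed.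

Lemma Vfun_eq0 t q : `|t| < T -> 1 <= q -> Vfun t q = 0.
Proof.
move=> tT; apply: (primitive_eq0_right (fun x => is_derive_Vfun x tT)).
  by rewrite VfunE// tail_integral1.
by move=> x x1; rewrite (profile_out ha) ?mul0r ?oppr0//; right.
Qed.

Lemma Kfun_ge1 t q : 0 <= t < T -> 1 <= Kfun t q.
Proof.
move=> /andP[t0 tT]; have nt : `|t| < T by rewrite ger0_norm.
apply: (cvgn_ge_from (N0 := 1%N) (Ksum_cvg (q := q) nt)) => -[//|N] _.
rewrite /Ksum big_ord_recl /= expr0 mulr1 lerDl; apply: sumr_ge0 => i _.
by rewrite mulr_ge0 ?exprn_ge0//; exact: Kcoef_ge0.
Qed.

Lemma Vfun_ge0 t q : 0 <= t < T -> 0 <= Vfun t q.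
Proof.
move=> /andP[t0 tT]; have nt : `|t| < T by rewrite ger0_norm.
apply: (cvgn_ge_from (N0 := 0%N) (Vsum_cvg (q := q) nt)) => N _.
exact: Vsum_ge0.
Qed.

Lemma Kfun0 q : Kfun 0 q = 1.
Proof.
have nt : `|0 : R| < T by rewrite normr0 lifespan_gt0.
have cK := Ksum_cvg (q := q) nt.
apply/eqP; rewrite eq_le; apply/andP; split.
  by apply: (cvgn_le_from (N0 := 1%N) cK) => -[//|N] _; rewrite Ksum0.
by apply: (cvgn_ge_from (N0 := 1%N) cK) => -[//|N] _; rewrite Ksum0.
Qed.

(** The derivative sums are monotone in [N] and bounded by [a K V]; [dKsum_ge] at the doubled order
    shows that nothing is lost in the limit. *)
Lemma dKsum_cvg t q : 0 <= t < T ->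
  dKsum a N t q @[N --> \oo] --> a q * (Kfun t q * Vfun t q).
Proof.
move=> /andP[t0 tT]; have nt : `|t| < T by rewrite ger0_norm.
have cKV : a q * (Ksum a N t q * Vsum a N t q) @[N --> \oo] -->
    a q * (Kfun t q * Vfun t q).
  apply: cvgMr; apply: cvgM; [exact: Ksum_cvg|exact: Vsum_cvg].
have dK_homo : {homo (fun N => dKsum a N t q) : M N / (M <= N)%N >-> M <= N}.
  move=> M N; apply: (@sum_ord_le _ (fun i => i.+1%:R * Kcoef a i.+1 q * t ^+ i)) => i.
  by rewrite mulr_ge0 ?exprn_ge0// mulr_ge0//; exact: Kcoef_ge0.
have KV_homo : {homo (fun N => a q * (Ksum a N t q * Vsum a N t q)) : M N / (M <= N)%N >-> M <= N}.
  move=> M N MN; apply: ler_wpM2l; first exact: profile_ge0.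
  apply: ler_pM; [exact: Ksum_ge0|exact: Vsum_ge0|..].
  - by apply: (@sum_ord_le _ (fun i => Kcoef a i q * t ^+ i)) => // i;
      rewrite mulr_ge0 ?exprn_ge0//; exact: Kcoef_ge0.
  - by apply: (@sum_ord_le _ (fun i => Vcoef a i q * t ^+ i)) => // i;
      rewrite mulr_ge0 ?exprn_ge0//; exact: Vcoef_ge0.
have KV_le N : a q * (Ksum a N t q * Vsum a N t q) <= a q * (Kfun t q * Vfun t q).
  by apply: (cvgn_ge_from (N0 := N) cKV) => M /KV_homo.
have cdK : cvgn (fun N => dKsum a N t q).
  apply: nondecreasing_is_cvgn => //.
  exists (a q * (Kfun t q * Vfun t q)) => _ [N _ <-].
  exact: le_trans (dKsum_le ha N q t0) (KV_le N).
suff -> : a q * (Kfun t q * Vfun t q) = limn (fun N => dKsum a N t q) by [].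
apply/eqP; rewrite eq_le; apply/andP; split.
  apply: (cvgn_le_from (N0 := 0%N) cKV) => N _.
  apply: le_trans (dKsum_ge ha N q t0) _.
  by apply: (cvgn_ge_from (N0 := (N + N)%N) cdK) => M /dK_homo.
apply: (cvgn_le_from (N0 := 0%N) cdK) => N _.
exact: le_trans (dKsum_le ha N q t0) (KV_le N).
Qed.

Lemma Kfun_increment x y q : 0 <= x <= y -> y < T ->
  (y - x) * (a q * (Kfun x q * Vfun x q)) <= Kfun y q - Kfun x q <=
  (y - x) * (a q * (Kfun y q * Vfun y q)).
Proof.
move=> xy yT; have /andP[x0 xley] := xy.
have xT := le_lt_trans xley yT; have y0 := le_trans x0 xley.
have inc N := Ksum_increment ha N q xy.
have cD : Ksum a N.+1 y q - Ksum a N.+1 x q @[N --> \oo] --> Kfun y q - Kfun x q.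
  apply: cvgB; rewrite (cvg_shiftS (fun N => Ksum a N _ q));
    by apply: Ksum_cvg; rewrite ger0_norm.
have cx : (y - x) * dKsum a N x q @[N --> \oo] --> (y - x) * (a q * (Kfun x q * Vfun x q)).
  by apply: cvgMr; apply: dKsum_cvg; rewrite x0.
have cy : (y - x) * dKsum a N y q @[N --> \oo] --> (y - x) * (a q * (Kfun y q * Vfun y q)).
  by apply: cvgMr; apply: dKsum_cvg; rewrite y0.
apply/andP; split.
  by apply: (ler_cvg_to cx cD); apply: nearW => N; case/andP: (inc N).
by apply: (ler_cvg_to cD cy); apply: nearW => N; case/andP: (inc N).
Qed.

(** By [Kfun_increment] the difference quotient lies between the values of the continuous function
    [a K V] at the two times, so it converges by squeezing. *)
Lemma is_derive_Kfun t q : 0 < t < T ->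
  is_derive t 1 (Kfun^~ q) (a q * (Kfun t q * Vfun t q)).
Proof.
move=> /andP[t0 tT]; have nt : `|t| < T by rewrite gtr0_norm.
pose F y := a q * (Kfun y q * Vfun y q).
have cF : {for t, continuous F}.
  apply: (@continuousM _ _ (fun=> a q)); first exact: cvg_cst.
  have cK := @continuous_slice_fst Kfun t q (Kfun_continuous (q := q) nt).
  have cV := @continuous_slice_fst Vfun t q (Vfun_continuous (q := q) nt).
  exact: continuousM cK cV.
apply/is_derive1_caratheodory.
exists (fun z => if z == t then F t else (Kfun z q - Kfun t q) / (z - t)); split.
- move=> z; case: eqP => [->|/eqP zt]; first by rewrite !subrr mulr0.
  by rewrite divfK// subr_eq0.
- change ((if z == t then F t else (Kfun z q - Kfun t q) / (z - t)) @[z --> t] -->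
    (if t == t then F t else (Kfun t q - Kfun t q) / (t - t))).
  rewrite eqxx; apply/cvgrPdist_le => e e0.
  have /cvgrPdist_le /(_ e e0) cF' := cF.
  near=> z.
  have hz : `|F t - F z| <= e by near: z.
  have z0 : 0 < z by near: z; exact: lt_nbhsr.
  have zT : z < T by near: z; exact: lt_nbhsl.
  case: eqP => [_|/eqP zt]; first by rewrite subrr normr0 ltW.
  have [zt'|tz|/eqP] := ltgtP z t; last by rewrite (negbTE zt).
  + have zt0 : 0 <= z <= t by rewrite !ltW.
    have /andP[h1 h2] := Kfun_increment q zt0 tT.
    have d0 : 0 < t - z by rewrite subr_gt0.
    have -> : (Kfun z q - Kfun t q) / (z - t) = (Kfun t q - Kfun z q) / (t - z).
      by rewrite -opprB -[z - t]opprB invrN mulrNN.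
    rewrite -/(F z) mulrC -ler_pdivlMr// in h1; rewrite -/(F t) mulrC -ler_pdivrMr// in h2.
    by move: hz; rewrite !ler_distl => /andP[? ?]; apply/andP; split; lra.
  + have zt0 : 0 <= t <= z by rewrite !ltW.
    have /andP[h1 h2] := Kfun_increment q zt0 zT.
    have d0 : 0 < z - t by rewrite subr_gt0.
    rewrite -/(F t) mulrC -ler_pdivlMr// in h1; rewrite -/(F z) mulrC -ler_pdivrMr// in h2.
    by move: hz; rewrite !ler_distl => /andP[? ?]; apply/andP; split; lra.
- by rewrite eqxx.
Unshelve. all: by end_near. Qed.

Lemma Kfun_unbounded B : exists t q, 0 <= t < T /\ B < Kfun t q.
Proof.
have [t [N [q [tT BK]]]] := Ksum_unbounded ha B.
exists t, q; split=> //; apply: (lt_le_trans BK).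
have /andP[t0 t1] := tT; have nt : `|t| < T by rewrite ger0_norm.
apply: (cvgn_ge_from (N0 := N) (Ksum_cvg (q := q) nt)) => M NM.
apply: (@sum_ord_le _ (fun i => Kcoef a i q * t ^+ i)) => // i.
by rewrite mulr_ge0 ?exprn_ge0//; exact: Kcoef_ge0.
Qed.

(* If [V <= M] then [K' = a K V <= M K], so that [K <= exp (M T)]. *)
Lemma Vfun_unbounded B : exists t q, 0 <= t < T /\ B < Vfun t q.
Proof.
apply: contrapT => hn; pose M := Num.max 0 B.
have M0 : 0 <= M by rewrite le_max lexx.
have VM t q : 0 <= t < T -> Vfun t q <= M.
  move=> tT; rewrite le_max; apply/orP; right; rewrite leNgt; apply/negP => h.
  by apply: hn; exists t, q.
have [t [q [tT]]] := Kfun_unbounded (expR (M * T)); rewrite ltNge => /negP; apply.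
have /andP[t0 t1] := tT.
pose f y := Kfun y q * expR (- M * y).
pose df y := a q * (Kfun y q * Vfun y q) * expR (- M * y)
  + Kfun y q * (expR (- M * y) * - M).
have dE y : is_derive y 1 (fun z : R => expR (- M * z)) (expR (- M * y) * - M).
  have d1 : is_derive y 1 (fun z : R => - M * z) (- M).
    apply: is_derive_eq (is_derive_fun_mul (is_derive_fun_cst (- M) y) (is_derive_fun_id y)) _.
    by rewrite mul0r add0r mulr1.
  exact: is_derive_fun_comp d1 (is_derive_expR _).
have [y|y|c] := @MVT_segment R f df 0 t t0.
- rewrite in_itv /= => /andP[y0 yt].
  have yT : 0 < y < T by rewrite y0 (lt_trans yt).
  exact: is_derive_fun_mul (is_derive_Kfun q yT) (dE y).
- apply: continuous_in_subspaceT => y'; rewrite inE /= in_itv /= => /andP[y0 yt].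
  have yT : `|y'| < T by rewrite ger0_norm// (le_lt_trans yt).
  have cK := @continuous_slice_fst Kfun y' q (Kfun_continuous (q := q) yT).
  exact: continuousM cK (is_derive_continuous (dE y')).
rewrite in_itv /= => /andP[c0 ct] E.
have cT : 0 <= c < T by rewrite c0 (le_lt_trans ct).
have dfc : df c <= 0.
  rewrite (_ : df c = expR (- M * c) * (a q * (Kfun c q * Vfun c q) - Kfun c q * M)); last first.
    by rewrite /df; ring.
  rewrite mulr_ge0_le0 ?expR_ge0// subr_le0.
  have K0 : 0 <= Kfun c q by rewrite (le_trans ler01)// Kfun_ge1.
  rewrite mulrCA ler_wpM2l// -[leRHS]mul1r; apply: ler_pM.
  - exact: profile_ge0.
  - exact: Vfun_ge0.
  - exact: profile_le1.
  - exact: VM.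
have : f t <= 1.
  have : df c * (t - 0) <= 0 by rewrite subr0 mulr_le0_ge0.
  by rewrite -E /f mulr0 expR0 mulr1 Kfun0 subr_le0.
rewrite /f mulNr expRN ler_pdivrMr ?expR_gt0// mul1r => /le_trans; apply.
by rewrite ler_expR ler_wpM2l// ltW.
Qed.

(** Otherwise [primitive_bound] would bound [V], whose derivative in [q] is [- a K]. The factor [a]
    matters because [U_q] is a multiple of [a K]. *)
Lemma aKfun_unbounded B : exists t q, 0 <= t < T /\ B < a q * Kfun t q.
Proof.
have [t [q [tT BV]]] := Vfun_unbounded (Num.max 0 B).
have nt : `|t| < T by case/andP: tT => t0 tT'; rewrite ger0_norm.
apply: contrapT => hn.
suff : `|Vfun t q| <= Num.max 0 B.
  by rewrite ger0_norm ?Vfun_ge0// leNgt BV.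
apply: (primitive_bound _ (fun x => is_derive_Vfun x nt)).
- exact: Vfun_eq0.
- by move=> x /(profile_out ha) ->; rewrite mul0r oppr0.
- move=> x; rewrite normrN ger0_norm.
    rewrite le_max; apply/orP; right; rewrite leNgt; apply/negP => h.
    by apply: hn; exists t, x.
  rewrite mulr_ge0 ?(profile_ge0 ha)// (le_trans ler01)// Kfun_ge1//.
Qed.

End ModelSolution.

(** * Unboundedness in the essential supremum norm *)

Section Within.
Context {R : realType}.

Lemma within_continuous_precomp (X Y Z : topologicalType) (D : set X) (E : set Y)
    (f : X -> Z) (g : Y -> X) :
  {within D, continuous f} -> continuous g -> (forall y, E y -> D (g y)) ->
  {within E, continuous (fun y => f (g y))}.
Proof.
move=> /subspace_continuousP cf cg ED; apply/subspace_continuousP => y Ey P Pfy.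
have := cf _ (ED _ Ey) P Pfy; rewrite !/nbhs /= /within /= => h.
by have := cg y _ h; rewrite /nbhs /=; apply: filterS => z hz Ez; apply: hz; exact: ED.
Qed.

(** Compactness of [[0, S] * [0, 1]]. It supplies the constants of the Gronwall argument, and the
    contradiction when a solution is assumed to outlive the blow-up. *)
Lemma slab_slice_bounded (T S : R) (w : R * R) (f : R -> R -> R * R -> R) :
  {within slab T, continuous (fun x => f x.1.1 x.1.2 x.2)} -> S < T -> circle w ->
  exists2 M, 0 <= M & forall s q, 0 <= s <= S -> 0 <= q <= 1 -> `|f s q w| <= M.
Proof.
move=> cf ST cw; pose E := [set` `[0, S]] `*` [set` `[(0 : R), 1]].
have cE : compact E by apply: compact_setX; exact: segment_compact.
have cg : continuous (fun z : R * R => (z, w)).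
  by move=> z; apply: continuous_pair; [exact: cvg_id|exact: cvg_cst].
have ED z : E z -> slab T (z, w).
  case: z => s q [/=]; rewrite !in_itv /= => /andP[s0 sS] _.
  by split=> //=; rewrite s0 (le_lt_trans sS).
have := compact_bounded (continuous_compact (within_continuous_precomp cf cg ED) cE).
move=> [M [_ hM]]; exists (Num.max 0 (M + 1)); first by rewrite le_max lexx.
move=> s q s0S q01; rewrite le_max; apply/orP; right.
apply: (hM (M + 1)); first by rewrite ltrDl.
by exists (s, q) => //; split; rewrite /= in_itv.
Qed.

Lemma circle_angle (w : R * R) : circle w ->
  exists2 t, 0 <= t < 2 * pi & w = angle t.
Proof.
case: w => x y; rewrite /circle /= => xy1.
have x1 : -1 <= x <= 1 by nra.
have xI : x \in `[-1, 1] by rewrite in_itv.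
have y2 : 1 - x ^+ 2 = y ^+ 2 by lra.
have a0 := acos_ge0 x1; have api := acos_lepi x1; have p0 := pi_gt0 R.
have [y0|y0] := leP 0 y.
  exists (acos x); first by rewrite a0 /=; lra.
  by rewrite /angle acosK// sin_acos// y2 sqrtr_sqr ger0_norm.
(* Strictness keeps the angle [2 pi - acos x] below [2 pi]; equality would force [x = 1] and
   [y = 0]. *)
have apos : 0 < acos x.
  rewrite lt_neqAle a0 andbT eq_sym; apply/eqP => h.
  by have := acosK xI; rewrite h cos0 => x1'; move: y2; rewrite -x1'; nra.
exists (2 * pi - acos x); first by apply/andP; split; lra.
rewrite /angle mulr_natl addrC cosD2pi sinD2pi cosN sinN acosK// sin_acos// y2.
by rewrite sqrtr_sqr ltr0_norm// opprK.
Qed.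

Lemma angle_circle (t : R) : circle (angle t).
Proof. by rewrite /circle /= cos2Dsin2. Qed.

Lemma angle_continuous : continuous (@angle R).
Proof.
by move=> t; apply: continuous_pair; [exact: continuous_cos|exact: continuous_sin].
Qed.

Lemma product_lebesgue_box (A B C : set (measurableTypeR R)) :
  measurable A -> measurable B -> measurable C ->
  ((@lebesgue_measure R \x @lebesgue_measure R) \x @lebesgue_measure R)%E
    ((A `*` B) `*` C) =
  (lebesgue_measure A * lebesgue_measure B * lebesgue_measure C)%E.
Proof.
move=> mA mB mC.
have mAB : measurable (A `*` B) by apply: measurableX.
rewrite product_measure1E//.
by congr (_ * _)%E; exact: product_measure1E.
Qed.

(** An essential supremum ignores single points, so continuity spreads each large value over a box
    of positive measure. The box extends only upwards from the point, which may lie on [s = 0] or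
    [t = 0]. *)
Lemma Linfty_norm_eqy (T : R) (f : R -> R -> R * R -> R) :
  {within slab T, continuous (fun x => f x.1.1 x.1.2 x.2)} ->
  (forall B, exists s q w, [/\ 0 <= s < T, circle w & B < `|f s q w|]) ->
  Linfty_norm T f = +oo%E.
Proof.
move=> cf unb.
pose m := ((@lebesgue_measure R \x @lebesgue_measure R) \x @lebesgue_measure R)%E.
pose D := [set x : R * R * R | 0 <= x.1.1 < T /\ 0 <= x.2 < 2 * pi].
pose F : R * R * R -> R := (fun x => f x.1.1 x.1.2 (angle x.2)) \_ D.
have box B : exists2 A : set (R * R * R), (0 < m A)%E &
    measurable A /\ forall x, A x -> B < `|F x|.
  have [s [q [w [sT cw Bf]]]] := unb B.
  have [t t2pi wt] := circle_angle cw; rewrite {}wt {w cw} in Bf.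
  have sl : slab T ((s, q), angle t) by split=> //; exact: angle_circle.
  have /subspace_continuousP /(_ _ sl) cfx := cf.
  have /cvgr_gt /(_ _ Bf) : `|f x.1.1 x.1.2 x.2| @[x --> within (slab T) (nbhs (s, q, angle t))]
      --> `|f s q (angle t)| by exact: cvg_norm cfx.
  rewrite !near_withinE => h.
  have cphi : {for (s, q, t), continuous (fun x : R * R * R => (x.1, angle x.2))}.
    apply: continuous_pair; first exact: cvg_fst.
    by apply: (@continuous_comp _ _ _ snd (@angle R)); [exact: cvg_snd|exact: angle_continuous].
  have hphi : nbhs (s, q, t) (fun x : R * R * R =>
    slab T (x.1, angle x.2) -> B < `|f x.1.1 x.1.2 (angle x.2)|) by exact: cphi _ h.
  move/nbhs_ballP : hphi => [e /= e0 he].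
  have /andP[s0 s1] := sT; have /andP[t0 t1] := t2pi.
  (* The side keeps the box inside the ball of radius [e], before time [T] and below the angle
     [2 pi]. *)
  pose d := Num.min (e / 2) (Num.min ((T - s) / 2) ((2 * pi - t) / 2)).
  have d0 : 0 < d by rewrite !lt_min !divr_gt0//= subr_gt0.
  have de : d <= e / 2 by rewrite ge_min lexx.
  have dT : d <= (T - s) / 2 by rewrite !ge_min lexx orbT.
  have dpi : d <= (2 * pi - t) / 2 by rewrite !ge_min lexx !orbT.
  pose I (x : R) : set (measurableTypeR R) := [set` `[x, x + d]].
  have mI x : lebesgue_measure (I x) = d%:E.
    by rewrite lebesgue_measure_itv /= lte_fin ltrDl d0 -EFinB addrAC subrr add0r.
  have measI x : measurable (I x) by exact: measurable_itv.
  have measIq : measurable (I s `*` I q) by apply: measurableX; exact: measI.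
  have measB : measurable ((I s `*` I q) `*` I t) by apply: measurableX.
  exists ((I s `*` I q) `*` I t); last split.
  - suff -> : m ((I s `*` I q) `*` I t) = (d%:E * d%:E * d%:E)%E.
      by rewrite -!EFinM lte_fin !mulr_gt0.
    by have := product_lebesgue_box (measI s) (measI q) (measI t); rewrite !mI.
  - exact: measB.
  - move=> [[s' q'] t'] [[/=]]; rewrite /I /= !in_itv /=.
    move=> /andP[ss' s's] /andP[qq' q'q] /andP[tt' t't].
    have s'T : 0 <= s' < T by apply/andP; split; lra.
    have t'pi : 0 <= t' < 2 * pi by apply/andP; split; lra.
    have : ball (s, q, t) e (s', q', t').
      have ab (x x' : R) : x <= x' -> x' <= x + d -> `|x - x'| < e.
        by move=> ? ?; rewrite ltr_distl; apply/andP; split; lra.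
      by split; [split; exact: ab|exact: ab].
    move=> /he /= /(_ (conj s'T (angle_circle t'))).
    by rewrite /F patchE mem_set.
(* The norm with exponent [+oo] is the essential supremum only if the whole space has positive
   measure. *)
have mT : (0 < m setT)%E.
  have [A A0 [mA _]] := box 0.
  by apply: (lt_le_trans A0); apply: le_measure; rewrite ?inE.
rewrite /Linfty_norm Lnorm.unlock /= -/m mT.
apply/eqP; rewrite eq_le leey /= leNgt; apply/negP => Ly.
have [r /ess_supP [N [mN N0 subN]]] : exists r : R, (ess_sup m (abse \o (EFin \o F)) <= r%:E)%E.
  case: (ess_sup m (abse \o (EFin \o F))) Ly => [r| |] //= _; first by exists r.
  by exists 0; rewrite leNye.
have [A A0 [mA AF]] := box r.
have : (m A <= m N)%E.
  apply: le_measure; rewrite ?inE// => x Ax; apply: subN => /=.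
  by apply/negP; rewrite -ltNge lte_fin AF.
have -> : m N = 0%E by exact: N0.
by rewrite leNgt A0.
Qed.

End Within.

(** * Uniqueness *)

Section SolutionProperties.
Context {R : realType}.

(** Mean value theorem for [g + f] and [g - f]. For [f] the derivative is required only in the open
    interval, as the equations in [s] hold for [s > 0]. *)
Lemma derive_comparison (f g df dg : R -> R) (s : R) : 0 <= s ->
  (forall x : R, 0 < x < s -> is_derive x 1 f (df x)) ->
  {within `[0, s], continuous f} -> (forall x : R, is_derive x 1 g (dg x)) ->
  (forall x, 0 < x < s -> `|df x| <= dg x) -> `|f s - f 0| <= g s - g 0.
Proof.
move=> s0 dfE cf dgE dfg.
have cg : {within `[0, s], continuous g}.
  by apply: continuous_subspaceT => x; exact: is_derive_continuous (dgE x).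
have [->|sN0] := eqVneq s 0; first by rewrite !subrr normr0.
have {sN0} s_gt0 : 0 < s by rewrite lt_neqAle eq_sym sN0.
have sum_ge0 (c : R) : `|c| <= 1 -> 0 <= (g s + c * f s) - (g 0 + c * f 0).
  move=> c1.
  have [|x||x] := @MVT R (fun x => g x + c * f x) (fun x => dg x + c * df x) 0 s.
  - exact: s_gt0.
  - rewrite in_itv /= => x0s.
    have := is_derive_fun_add (dgE x)
      (is_derive_fun_mul (is_derive_fun_cst c x) (dfE x x0s)).
    by rewrite mul0r add0r.
  - move/subspace_continuousP in cf; move/subspace_continuousP in cg.
    apply/subspace_continuousP => x xD; apply: cvgD; first exact: cg.
    by apply: cvgM; [exact: cvg_cst|exact: cf].
  rewrite in_itv /= => x0s ->; rewrite subr0 mulr_ge0 ?(ltW s_gt0)//.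
  have h1 := dfg x x0s.
  have h2 : `|c * df x| <= dg x.
    by rewrite normrM -[leRHS]mul1r; apply: ler_pM.
  have : - dg x <= c * df x by move: h2; rewrite ler_norml => /andP[].
  lra.
have h1 := sum_ge0 1; have h2 := sum_ge0 (-1).
rewrite ler_norml; apply/andP; split.
  have := h1; rewrite normr1 lexx => /(_ isT); lra.
have := h2; rewrite normrN1 lexx => /(_ isT); lra.
Qed.

Context (G : R * R -> R) (A : R -> R * R -> R).
Context (A_out : forall q w, q <= 0 \/ 1 <= q -> A q w = 0).

Section OneSolution.
Context (T : R) (mu U : R -> R -> R * R -> R) (hs : solution G A T mu U).
Context (w : R * R) (cw : circle w).
Implicit Types s q S : R.

Lemma slab_time_continuous (f : R -> R -> R * R -> R) S q : S < T ->
  {within slab T, continuous (fun x => f x.1.1 x.1.2 x.2)} ->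
  {within `[0, S], continuous (fun s => f s q w)}.
Proof.
move=> ST cf.
have cg : continuous (fun s : R => ((s, q), w)).
  move=> s; apply: continuous_pair; last exact: cvg_cst.
  by apply: continuous_pair; [exact: cvg_id|exact: cvg_cst].
apply: (within_continuous_precomp cf cg) => s /=; rewrite in_itv /= => /andP[s0 sS].
by split=> //=; rewrite s0 (le_lt_trans sS).
Qed.

Lemma solution_muUq s q : 0 <= s < T -> mu s q w * dq U s q w = - 2 * A q w.
Proof.
move=> /andP[s0 sT].
have [x||x _] := @MVT_segment R (fun s => mu s q w * dq U s q w) (fun=> 0) 0 s s0.
- rewrite in_itv /= => /andP[x0 xs]; apply: (sol_muUq hs) => //.
  by rewrite x0 (lt_trans xs).
- have /subspace_continuousP c1 := slab_time_continuous (q := q) sT (sol_mu_cont hs).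
  have /subspace_continuousP c2 := slab_time_continuous (q := q) sT (sol_dqU_cont hs).
  by apply/subspace_continuousP => x xD; apply: cvgM; [exact: c1|exact: c2].
rewrite mul0r (sol_init_mu hs)// (sol_init_Uq hs)// => /eqP.
by rewrite subr_eq0 => /eqP.
Qed.

Lemma is_derive_solution_mu s q : 0 < s < T ->
  is_derive s 1 (fun s => mu s q w) (- (G w * A q w * U s q w * mu s q w)).
Proof.
move=> sT; apply: is_derive_eq (sol_mu hs q sT cw) _.
have sT' : 0 <= s < T by case/andP: sT => /ltW -> ->.
have h := solution_muUq q sT'.
rewrite (_ : 2^-1 * _ * _ * _ * _ =
    2^-1 * G w * mu s q w * U s q w * (mu s q w * dq U s q w)); last by ring.
by rewrite h; field.
Qed.

Lemma solution_mu_cst s q : 0 <= s < T -> A q w = 0 -> mu s q w = - 2.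
Proof.
move=> /andP[s0 sT] A0.
have [x||x _] := @MVT_segment R (fun s => mu s q w) (fun=> 0) 0 s s0.
- rewrite in_itv /= => /andP[x0 xs].
  have xT : 0 < x < T by rewrite x0 (lt_trans xs).
  apply: is_derive_eq (is_derive_solution_mu q xT) _.
  by rewrite A0 mulr0 !mul0r oppr0.
- exact: (slab_time_continuous (q := q) sT (sol_mu_cont hs)).
rewrite mul0r (sol_init_mu hs)// => /eqP.
by rewrite subr_eq0 => /eqP.
Qed.

Lemma solution_mu_neq0 s q : 0 <= s < T -> mu s q w != 0.
Proof.
move=> sT; have [A0|A0] := eqVneq (A q w) 0.
  by rewrite solution_mu_cst// oppr_eq0 pnatr_eq0.
apply/eqP => mu0; have := solution_muUq q sT; rewrite mu0 mul0r => /esym/eqP.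
by rewrite mulf_eq0 oppr_eq0 pnatr_eq0 (negbTE A0).
Qed.

(** The function [kappa] of an arbitrary solution, read off from [mu = - 2 / kappa] rather than from
    the exponential of an integral. *)
Definition ksol s q := - 2 / mu s q w.

Lemma is_derive_ksol s q : 0 < s < T ->
  is_derive s 1 (ksol^~ q) (G w * A q w * U s q w * ksol s q).
Proof.
move=> sT; have sT' : 0 <= s < T by case/andP: sT => /ltW -> ->.
have mu0 := solution_mu_neq0 q sT'.
have dV := is_deriveV (f := fun s => mu s q w) mu0 (is_derive_solution_mu q sT).
apply: is_derive_eq (is_derive_fun_mul (is_derive_fun_cst (- 2) s) dV) _.
by rewrite /ksol /GRing.scale /=; field.
Qed.

Lemma is_derive_solution_U s q : 0 <= s < T ->
  is_derive q 1 (fun q' => U s q' w) (A q w * ksol s q).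
Proof.
move=> sT; apply: DeriveDef; first exact: (sol_U_derivable hs).
have h := solution_muUq q sT; have mu0 := solution_mu_neq0 q sT.
rewrite -derive1E -[LHS]/(dq U s q w) /ksol.
apply: (mulfI mu0); rewrite h; field; exact: mu0.
Qed.

(** Right of the support [U_q = A kappa] vanishes, so [U] is constant there and equal to its limit
    0. *)
Lemma solution_U_eq0 s q : 0 <= s < T -> 1 <= q -> U s q w = 0.
Proof.
move=> sT q1; apply/eqP/negPn/negP => U0.
have := sol_lim hs sT cw => /cvgrPdist_lt /(_ `|U s q w|).
rewrite normr_gt0 => /(_ U0) h.
have [y [qy]] := filter_ex (filterI (nbhs_pinfty_ge (num_real q)) h).
have [c] := MVT_everywhere q y (fun x => is_derive_solution_U x sT).
rewrite (min_idPl qy) => /andP[qc _].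
rewrite A_out ?mul0r; last by right; exact: le_trans qc.
by move=> /eqP; rewrite subr_eq0 => /eqP ->; rewrite sub0r normrN ltxx.
Qed.

Lemma ksol_time_continuous S q : S < T -> {within `[0, S], continuous (ksol^~ q)}.
Proof.
move=> ST; have /subspace_continuousP cmu := slab_time_continuous (q := q) ST (sol_mu_cont hs).
apply/subspace_continuousP => s sS; apply: cvgM; first exact: cvg_cst.
apply: cvgV; last exact: cmu.
apply: solution_mu_neq0; move: sS; rewrite /= in_itv /= => /andP[-> sS].
exact: le_lt_trans ST.
Qed.

End OneSolution.

Lemma ksol_slice_bounded T mu U w S : solution G A T mu U -> S < T -> circle w ->
  exists2 M, 0 <= M & forall s q, 0 <= s <= S -> 0 <= q <= 1 -> `|ksol mu w s q| <= M.
Proof.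
move=> hs ST cw.
apply: (@slab_slice_bounded R T S w (fun s q w => - 2 / mu s q w)) => //.
have /subspace_continuousP cmu := sol_mu_cont hs.
apply/subspace_continuousP => x xD; apply: cvgM; first exact: cvg_cst.
apply: cvgV; last exact: cmu.
by case: xD => xT cx; exact: (solution_mu_neq0 hs).
Qed.

(** Contraction in the norm weighted by [exp (- lam s)]: each passage through the integral equation
    halves the bound on the difference [D], and the bounds [C / 2 ^ n] tend to 0. *)
Lemma ksol_agree T1 mu1 U1 T2 mu2 U2 w S s q :
  solution G A T1 mu1 U1 -> solution G A T2 mu2 U2 -> S < T1 -> S < T2 ->
  circle w -> 0 <= s <= S -> 0 <= q <= 1 -> ksol mu1 w s q = ksol mu2 w s q.
Proof.
move=> h1 h2 S1 S2 cw sS q01.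
have [K1 K1_ge0 hK1] := ksol_slice_bounded h1 S1 cw.
have [K2 K2_ge0 hK2] := ksol_slice_bounded h2 S2 cw.
have [M M_ge0 hM] := slab_slice_bounded (sol_U_cont h1) S1 cw.
have [L L_ge0 hL] := slab_slice_bounded (sol_dqU_cont h1) S1 cw.
have S0 : 0 <= S by case/andP: sS => ? ?; lra.
have AL y : 0 <= y <= 1 -> `|A y w| <= L.
  by move=> y01; rewrite -(sol_init_Uq h1)//; apply: hL => //; rewrite lexx.
(* Twice the Lipschitz constant: [D_s = G A (U1 D + (U1 - U2) kappa2)] with [|A| <= L], [|U1| <= M],
   [|kappa2| <= K2] and [|U1 - U2| <= L sup |D|]. Integrating the weight then gains the factor
   1/2. *)
pose lam := 2 * (`|G w| * L * (M + K2 * L)).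
have lam0 : 0 <= lam by rewrite !mulr_ge0// addr_ge0// mulr_ge0.
pose D s q := ksol mu1 w s q - ksol mu2 w s q.
pose C := K1 + K2.
have C0 : 0 <= C by rewrite addr_ge0.
have key n : forall s q, 0 <= s <= S -> 0 <= q <= 1 ->
    `|D s q| <= C / 2 ^+ n * expR (lam * s).
  elim: n => [|n IH] {sS q01} {}s {}q sS q01.
    rewrite expr0 divr1 -[leLHS]mulr1; apply: ler_pM => //.
      apply: (le_trans (ler_normB _ _)); apply: lerD; [exact: hK1|exact: hK2].
    by rewrite -expR0 ler_expR mulr_ge0//; case/andP: sS.
  have /andP[s0 sleS] := sS; have /andP[q0 q1] := q01.
  pose B := C / 2 ^+ n.
  have B0 : 0 <= B by rewrite divr_ge0// exprn_ge0.
  (* The nonlocal term: [U1 - U2] vanishes at [q = 1] and has derivative [A D], so it is controlled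
     by [D] on [[q, 1]] at the same time. *)
  have hu x : 0 <= x <= S -> `|U1 x q w - U2 x q w| <= L * (B * expR (lam * x)).
    move=> xS; have /andP[x0 xleS] := xS.
    have x1 : 0 <= x < T1 by rewrite x0 (le_lt_trans xleS).
    have x2 : 0 <= x < T2 by rewrite x0 (le_lt_trans xleS).
    have dD (y : R) : is_derive y 1 (fun y => U1 x y w - U2 x y w) (A y w * D x y).
      apply: is_derive_eq (is_derive_fun_add (is_derive_solution_U h1 cw y x1)
        (is_deriveN (is_derive_solution_U h2 cw y x2))) _.
      by rewrite /D mulrBr.
    have [y] := MVT_everywhere q 1 dD.
    rewrite (min_idPl q1) (max_idPr q1) => /andP[qy y1].
    rewrite (solution_U_eq0 h1)// (solution_U_eq0 h2)// subrr sub0r => E.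
    have y01 : 0 <= y <= 1 by rewrite (le_trans q0).
    rewrite -normrN E normrM -[leRHS]mulr1; apply: ler_pM => //.
    - by rewrite normrM; apply: ler_pM => //; [exact: AL|exact: IH].
    - by rewrite ger0_norm ?subr_ge0//; lra.
  have dDt (x : R) : 0 < x < s -> is_derive x 1 (D^~ q)
      (G w * A q w * (U1 x q w * D x q + (U1 x q w - U2 x q w) * ksol mu2 w x q)).
    move=> /andP[x0 xs].
    have x1 : 0 < x < T1 by rewrite x0 (lt_trans xs)// (le_lt_trans sleS).
    have x2 : 0 < x < T2 by rewrite x0 (lt_trans xs)// (le_lt_trans sleS).
    apply: is_derive_eq (is_derive_fun_add (is_derive_ksol h1 cw q x1)
      (is_deriveN (is_derive_ksol h2 cw q x2))) _.
    by rewrite /D; ring.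
  have cD : {within `[0, s], continuous (D^~ q)}.
    have sT1 := le_lt_trans sleS S1; have sT2 := le_lt_trans sleS S2.
    have /subspace_continuousP c1 := ksol_time_continuous h1 cw (q := q) sT1.
    have /subspace_continuousP c2 := ksol_time_continuous h2 cw (q := q) sT2.
    by apply/subspace_continuousP => x xD; apply: cvgB; [exact: c1|exact: c2].
  have dg (x : R) : is_derive x 1 (fun x => B / 2 * expR (lam * x))
      (B / 2 * (lam * expR (lam * x))).
    have d1 : is_derive x 1 (fun z : R => lam * z) lam.
      apply: is_derive_eq (is_derive_fun_mul (is_derive_fun_cst lam x) (is_derive_fun_id x)) _.
      by rewrite mul0r add0r mulr1.
    apply: is_derive_eq (is_derive_fun_mul (is_derive_fun_cst (B / 2) x)
      (is_derive_fun_comp d1 (is_derive_expR _))) _.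
    by rewrite mul0r add0r; congr (_ * _); exact: mulrC.
  have := derive_comparison s0 dDt cD dg.
  have D0 : D 0 q = 0.
    by rewrite /D /ksol (sol_init_mu h1)// (sol_init_mu h2)// subrr.
  rewrite D0 subr0 => /(_ _)/le_trans; apply.
    move=> x /andP[x0 xs].
    have xS : 0 <= x <= S by rewrite (ltW x0) (le_trans (ltW xs)).
    set e := expR (lam * x); have e0 : 0 <= e by exact: expR_ge0.
    have -> : B / 2 * (lam * e) = `|G w| * L * (M * (B * e) + L * (B * e) * K2).
      by rewrite /lam; field.
    rewrite normrM; apply: ler_pM => //.
      by rewrite normrM; apply: ler_pM => //; exact: AL.
    apply: (le_trans (ler_normD _ _)); apply: lerD; rewrite normrM; apply: ler_pM => //.
    - exact: hM.
    - exact: IH.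
    - exact: hu.
    - exact: hK2.
  rewrite mulr0 expR0 mulr1 exprS invfM mulrA -/B.
  have -> : C / 2 / 2 ^+ n = B / 2 by rewrite /B; ring.
  by rewrite gerBl divr_ge0.
apply/eqP; rewrite -subr_eq0 -normr_le0.
have cv : (fun n => C / 2 ^+ n * expR (lam * s)) @ \oo --> C * 0 * expR (lam * s).
  apply: cvgMl; apply: cvgMr.
  rewrite (_ : (fun n => _) = (fun n => (2^-1 : R) ^+ n)); last first.
    by apply/funext => n; rewrite exprVn.
  by apply: cvg_expr; rewrite ger0_norm ?invr_ge0// invf_lt1// ltr1n.
rewrite mulr0 mul0r in cv.
apply: (cvgn_ge_from (N0 := 0%N) cv) => n _; exact: key.
Qed.

Lemma solution_unique T1 mu1 U1 T2 mu2 U2 w s q :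
  solution G A T1 mu1 U1 -> solution G A T2 mu2 U2 -> circle w ->
  0 <= s < T1 -> s < T2 -> mu1 s q w = mu2 s q w /\ U1 s q w = U2 s q w.
Proof.
move=> h1 h2 cw s1 s2; have /andP[s0 sT1] := s1.
have s2' : 0 <= s < T2 by rewrite s0.
have mu12 y : mu1 s y w = mu2 s y w.
  have [y0|y0] := leP y 0.
    by rewrite (solution_mu_cst h1)// ?(solution_mu_cst h2)// A_out//; left.
  have [y1|y1] := leP 1 y.
    by rewrite (solution_mu_cst h1)// ?(solution_mu_cst h2)// A_out//; right.
  have : ksol mu1 w s y = ksol mu2 w s y.
    by apply: (ksol_agree h1 h2 sT1 s2 cw); rewrite ?s0 ?lexx// !ltW.
  have n2 : - 2 != 0 :> R by rewrite oppr_eq0 pnatr_eq0.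
  by move=> /(mulfI n2) /invr_inj.
split; first exact: mu12.
have dD (y : R) : is_derive y 1 (fun y => U1 s y w - U2 s y w) 0.
  apply: is_derive_eq (is_derive_fun_add (is_derive_solution_U h1 cw y s1)
    (is_deriveN (is_derive_solution_U h2 cw y s2'))) _.
  by rewrite /ksol mu12 subrr.
have [y _] := MVT_everywhere q 1 dD.
rewrite (solution_U_eq0 h1)// (solution_U_eq0 h2)// subrr mul0r sub0r => /eqP.
by rewrite oppr_eq0 subr_eq0 => /eqP.
Qed.

End SolutionProperties.

(** * Data in product form *)

Section ProductData.
Context {R : realType} (a : R -> R) (ha : profile a).
Context (G b : R * R -> R) (G_cont : continuous G) (b_cont : continuous b).

(** In [kappa_s = - G A kappa (integral of A kappa)] the datum occurs twice, once under the
    integral, whence the square of [b]. *)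
Definition sigma (w : R * R) : R := - G w * b w ^+ 2.

Context (sigma_ge0 : forall w, 0 <= sigma w).
Context (w1 : R * R) (cw1 : circle w1) (sigma1_gt0 : 0 < sigma w1).
Context (sigma_max : forall w, circle w -> sigma w <= sigma w1).
Implicit Types (s q B : R) (w : R * R).

Definition product_data q w := a q * b w.
Definition blowup_time := lifespan a / sigma w1.
Definition product_U s q w := - (b w * Vfun a (sigma w * s) q).
Definition product_mu s q w := - 2 / Kfun a (sigma w * s) q.

Let T := blowup_time.

Lemma blowup_time_gt0 : 0 < T.
Proof. by rewrite divr_gt0// lifespan_gt0. Qed.

Lemma sigma_lt_lifespan s w : 0 <= s < T -> circle w -> 0 <= sigma w * s < lifespan a.
Proof.
move=> /andP[s0 sT] cw; rewrite mulr_ge0//=.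
apply: (@le_lt_trans _ _ (sigma w1 * s)); first by rewrite ler_wpM2r// sigma_max.
by rewrite mulrC -ltr_pdivlMr.
Qed.

Lemma norm_sigma_lt_lifespan s w : 0 <= s < T -> circle w -> `|sigma w * s| < lifespan a.
Proof. by move=> sT cw; have /andP[? ?] := sigma_lt_lifespan sT cw; rewrite ger0_norm. Qed.

Lemma sigma_continuous : continuous sigma.
Proof.
move=> w; have c1 : {for w, continuous (fun w => - G w)} by apply: continuousN; exact: G_cont.
have c2 : {for w, continuous (fun w => b w ^+ 2)}.
  by apply: (@continuous_comp _ _ _ b (fun x : R => x ^+ 2));
    [exact: b_cont|exact: exprn_continuous].
exact: continuousM c1 c2.
Qed.

Lemma scaled_continuous (f : R -> R -> R) :
  (forall t q, `|t| < lifespan a -> {for (t, q), continuous (fun x : R * R => f x.1 x.2)}) ->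
  {within slab T, continuous
    (fun x : R * R * (R * R) => f (sigma x.2 * x.1.1) x.1.2)}.
Proof.
move=> cf; apply: continuous_in_subspaceT => x; rewrite inE => -[xT cx].
have c1 : {for x, continuous (fun x : R * R * (R * R) => sigma x.2)}.
  by apply: (@continuous_comp _ _ _ snd sigma); [exact: cvg_snd|exact: sigma_continuous].
have c2 : {for x, continuous (fun x : R * R * (R * R) => x.1.1)}.
  by apply: (@continuous_comp _ _ _ fst fst); exact: cvg_fst.
have c3 : {for x, continuous (fun x : R * R * (R * R) => x.1.2)}.
  by apply: (@continuous_comp _ _ _ fst snd); [exact: cvg_fst|exact: cvg_snd].
apply: (@continuous_comp _ _ _ (fun x : R * R * (R * R) => (sigma x.2 * x.1.1, x.1.2))
  (fun z => f z.1 z.2)).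
  exact: continuous_pair (continuousM c1 c2) c3.
exact/cf/norm_sigma_lt_lifespan.
Qed.

Lemma scaled_Kfun_continuous : {within slab T, continuous
  (fun x : R * R * (R * R) => Kfun a (sigma x.2 * x.1.1) x.1.2)}.
Proof. by apply: scaled_continuous => t q tT; exact: Kfun_continuous. Qed.

Lemma scaled_Vfun_continuous : {within slab T, continuous
  (fun x : R * R * (R * R) => Vfun a (sigma x.2 * x.1.1) x.1.2)}.
Proof. by apply: scaled_continuous => t q tT; exact: Vfun_continuous. Qed.

Lemma scaled_Kfun_gt0 s q w : 0 <= s < T -> circle w -> 0 < Kfun a (sigma w * s) q.
Proof.
move=> sT cw; apply: lt_le_trans ltr01 _; apply: Kfun_ge1 => //.
exact: sigma_lt_lifespan.
Qed.

Lemma is_derive_product_U s q w : 0 <= s < T -> circle w ->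
  is_derive q 1 (fun q' => product_U s q' w) (b w * (a q * Kfun a (sigma w * s) q)).
Proof.
move=> sT cw; have dV := is_derive_Vfun ha q (norm_sigma_lt_lifespan sT cw).
have d := is_deriveN (is_derive_fun_mul (is_derive_fun_cst (b w) q) dV).
by apply: is_derive_eq d _; ring.
Qed.

Lemma dq_product_U s q w : 0 <= s < T -> circle w ->
  dq product_U s q w = b w * (a q * Kfun a (sigma w * s) q).
Proof.
by move=> sT cw; rewrite /dq derive1E; case: (is_derive_product_U q sT cw).
Qed.

Lemma is_derive_scaled_Kfun s q w : 0 < s < T -> circle w ->
  is_derive s 1 (fun s' => Kfun a (sigma w * s') q)
    (sigma w * (a q * (Kfun a (sigma w * s) q * Vfun a (sigma w * s) q))).
Proof.
(* The model equation is available only at positive model times. Where [sigma] vanishes the model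
   time stays at 0 and the function is constant in [s]. *)
move=> /andP[s0 sT] cw; have [S0|S0] := eqVneq (sigma w) 0.
  rewrite S0 mul0r (_ : (fun s' => _) = fun=> Kfun a 0 q).
    exact: is_derive_cst.
  by apply/funext => s'; rewrite mul0r.
have dl : is_derive s 1 (fun s' : R => sigma w * s') (sigma w).
  apply: is_derive_eq (is_derive_fun_mul (is_derive_fun_cst (sigma w) s) (is_derive_fun_id s)) _.
  by rewrite mul0r add0r mulr1.
have sp : 0 < sigma w * s < lifespan a.
  have /andP[_ ->] : 0 <= sigma w * s < lifespan a.
    by apply: sigma_lt_lifespan => //; rewrite ltW.
  by rewrite andbT mulr_gt0// lt_neqAle eq_sym S0 sigma_ge0.
rewrite mulrC; exact: (is_derive_fun_comp dl (is_derive_Kfun ha q sp)).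
Qed.

Lemma product_solution : solution G product_data T product_mu product_U.
Proof.
have b2 : continuous (fun x : R * R * (R * R) => b x.2).
  by move=> x; apply: (@continuous_comp _ _ _ snd b); [exact: cvg_snd|exact: b_cont].
have a2 : continuous (fun x : R * R * (R * R) => a x.1.2).
  move=> x; apply: (@continuous_comp _ _ _ fst (fun z => a z.2)); first exact: cvg_fst.
  by apply: (@continuous_comp _ _ _ snd a); [exact: cvg_snd|exact: profile_continuous].
have /subspace_continuousP cK := scaled_Kfun_continuous.
have /subspace_continuousP cV := scaled_Vfun_continuous.
have inw (f : R * R * (R * R) -> R) x : continuous f ->
    f y @[y --> within (slab T) (nbhs x)] --> f x.
  by move=> cf; apply: cvg_within_filter; exact: cf.
have cdU : {within slab T, continuous
    (fun x => b x.2 * (a x.1.2 * Kfun a (sigma x.2 * x.1.1) x.1.2))}.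
  apply/subspace_continuousP => x xD; apply: cvgM; first exact: inw b2.
  by apply: cvgM; [exact: inw a2|exact: cK].
split.
- apply/subspace_continuousP => x xD; apply: cvgM; first exact: cvg_cst.
  apply: cvgV; last exact: cK.
  by case: xD => xT cx; rewrite gt_eqF// scaled_Kfun_gt0.
- apply/subspace_continuousP => x xD; apply: cvgN.
  by apply: cvgM; [exact: inw b2|exact: cV].
- by move=> s q w sT cw; case: (is_derive_product_U q sT cw).
- apply: subspace_eq_continuous cdU => x; rewrite inE => -[xT cx].
  exact/esym/dq_product_U.
- move=> s q w /andP[s0 sT] cw.
  (* The factor [K] cancels in [mu U_q], but only at times of the slab, so the product is constant
     merely near [s]. *)
  apply: (@near_eq_is_derive _ _ _ (fun _ : R => - 2 * (b w * a q))).
  near=> y.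
  have yT : 0 <= y < T.
    apply/andP; split; last by near: y; exact: lt_nbhsl.
    by apply: ltW; near: y; exact: lt_nbhsr.
  have K0 := scaled_Kfun_gt0 q yT cw.
  by rewrite dq_product_U// /product_mu; field; rewrite gt_eqF.
- move=> s q w sT cw; have sT' : 0 <= s < T by case/andP: sT => /ltW -> ->.
  have K0 : Kfun a (sigma w * s) q != 0 by rewrite gt_eqF// scaled_Kfun_gt0.
  have dV := is_deriveV (f := fun s => Kfun a (sigma w * s) q) K0
    (is_derive_scaled_Kfun q sT cw).
  apply: is_derive_eq (is_derive_fun_mul (is_derive_fun_cst (- 2) s) dV) _.
  rewrite dq_product_U// /product_mu /product_U /GRing.scale /=.
  set K := Kfun _ _ _ in K0 *; set V := Vfun _ _ _.
  by rewrite [in LHS]/sigma; field.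
- move=> s w sT cw; apply/cvgrPdist_lt => e e0; near=> y.
  have y1 : 1 <= y by near: y; exact: nbhs_pinfty_ge.
  by rewrite /product_U (Vfun_eq0 ha (norm_sigma_lt_lifespan sT cw) y1)
    mulr0 oppr0 subrr normr0.
- by move=> q w cw; rewrite /product_mu mulr0 Kfun0// divr1.
- move=> q w cw; rewrite dq_product_U ?lexx ?blowup_time_gt0//.
  by rewrite mulr0 Kfun0// mulr1 mulrC.
Unshelve. all: by end_near. Qed.

Lemma b1_neq0 : b w1 != 0.
Proof.
by apply/eqP => b0; move: sigma1_gt0; rewrite /sigma b0 expr0n mulr0 ltxx.
Qed.

Lemma unscale t : 0 <= t < lifespan a -> exists2 s, 0 <= s < T & sigma w1 * s = t.
Proof.
move=> /andP[t0 tT]; exists (t / sigma w1).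
  by rewrite divr_ge0 ?(ltW sigma1_gt0)//= ltr_pM2r// invr_gt0.
by rewrite mulrC divfK// gt_eqF.
Qed.

Lemma dq_product_U_unbounded B : exists s q, [/\ 0 <= s < T, 0 <= q <= 1 &
  B < `|dq product_U s q w1|].
Proof.
have b0 : 0 < `|b w1| by rewrite normr_gt0 b1_neq0.
(* The maximum with 0 makes [a q] nonzero, which places [q] in [[0, 1]] where compactness can be
   applied. *)
have [t [q [tT]]] := aKfun_unbounded ha (Num.max 0 (B / `|b w1|)).
rewrite gt_max => /andP[aK0 Bb].
have [s sT st] := unscale tT; exists s, q; split=> //.
  have out : ~ (q <= 0 \/ 1 <= q).
    by move=> /(profile_out ha) a0; move: aK0; rewrite a0 mul0r ltxx.
  by apply/andP; split; rewrite leNgt; apply/negP => /ltW hq; apply: out; [left|right].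
rewrite dq_product_U// st normrM mulrC -ltr_pdivrMr//.
exact: lt_le_trans Bb (ler_norm _).
Qed.

Lemma product_U_unbounded B : exists s q, 0 <= s < T /\ B < `|product_U s q w1|.
Proof.
have b0 : 0 < `|b w1| by rewrite normr_gt0 b1_neq0.
have [t [q [tT Bb]]] := Vfun_unbounded ha (B / `|b w1|).
have [s sT st] := unscale tT; exists s, q; split=> //.
rewrite /product_U normrN st normrM mulrC -ltr_pdivrMr//.
exact: lt_le_trans Bb (ler_norm _).
Qed.

Lemma product_data_out q w : q <= 0 \/ 1 <= q -> product_data q w = 0.
Proof. by move=> /(profile_out ha) h; rewrite /product_data h mul0r. Qed.

(** A solution on a longer interval would have [U_q] bounded on [[0, T] * [0, 1]] at the angle [w1],
    where [sigma] is largest. By uniqueness it agrees before [T] with the product solution, whose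
    [U_q] is unbounded there. *)
Lemma product_maximal : maximal_solution G product_data T product_mu product_U.
Proof.
split=> [|T' mu' U' T'0 h']; first exact: product_solution.
have agree s q w : 0 <= s < T' -> s < T -> circle w ->
    mu' s q w = product_mu s q w /\ U' s q w = product_U s q w.
  by move=> s1 s2 cw; exact: (solution_unique product_data_out q h' product_solution cw s1 s2).
have T'T : T' <= T.
  rewrite leNgt; apply/negP => TT'.
  have [M _ hM] := slab_slice_bounded (sol_dqU_cont h') TT' cw1.
  have [s [q [sT q01]]] := dq_product_U_unbounded M.
  have /andP[s0 sT1] := sT.
  rewrite ltNge => /negP; apply.
  have -> : dq product_U s q w1 = dq U' s q w1.
    rewrite /dq; congr (derive1 _ _); apply/funext => y.
    have sT' : 0 <= s < T' by rewrite s0 (lt_trans sT1).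
    by have [_ ->] := agree s y w1 sT' sT1 cw1.
  by apply: hM => //; rewrite s0 ltW.
split=> // s q w sT' cw; apply: agree => //.
by case/andP: sT' => _ /lt_le_trans; apply.
Qed.

(** The logarithm of [K (sigma s)] is a primitive of [G A U], as [sigma a V = G (a b) (- b V)]; the
    fundamental theorem then evaluates the integral in [kappa]. *)
Lemma kappa_product s q w : 0 <= s < T -> circle w ->
  kappa G product_data product_U s q w = Kfun a (sigma w * s) q.
Proof.
move=> sT cw; rewrite /kappa; have /andP[s0 sT1] := sT.
have [sE|sN0] := eqVneq s 0.
  by rewrite sE mulr0 Kfun0// set_itv1 Rintegral_set1 mulr0 expR0.
have s_gt0 : 0 < s by rewrite lt_neqAle eq_sym sN0.
pose u s' := product_U s' q w.
pose F s' := ln (Kfun a (sigma w * s') q).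
have cu : {within `[0, s], continuous u}.
  exact: (slab_time_continuous (q := q) cw sT1 (sol_U_cont product_solution)).
have /subspace_continuousP cK : {within `[0, s], continuous
    (fun s' => Kfun a (sigma w * s') q)}.
  exact: (@slab_time_continuous _ _ _ cw (fun s q w => Kfun a (sigma w * s) q) _ q sT1
    scaled_Kfun_continuous).
have cF : {within `[0, s], continuous F}.
  apply/subspace_continuousP => x xs; apply: continuous_cvg; last exact: cK.
  apply: continuous_ln; apply: scaled_Kfun_gt0 => //.
  by move: xs; rewrite /= in_itv /= => /andP[-> xs]; exact: le_lt_trans sT1.
have dF x : 0 < x < s -> is_derive x 1 F (G w * product_data q w * u x).
  move=> /andP[x0 xs]; have xT : 0 < x < T by rewrite x0 (lt_trans xs).
  have xT' : 0 <= x < T by rewrite (ltW x0) (lt_trans xs).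
  have K0 := scaled_Kfun_gt0 q xT' cw.
  apply: is_derive_eq (is_derive_fun_comp (is_derive_scaled_Kfun q xT cw) (is_derive1_ln K0)) _.
  rewrite /u /product_U /product_data.
  set K := Kfun _ _ _ in K0 *; set V := Vfun _ _ _.
  by rewrite [in LHS]/sigma; field; rewrite gt_eqF.
have iu : lebesgue_measure.-integrable `[0, s] (EFin \o u).
  by apply: continuous_compact_integrable => //; exact: segment_compact.
rewrite -RintegralZl//.
have cGu : {within `[0, s], continuous (fun x => G w * product_data q w * u x)}.
  move/subspace_continuousP in cu; apply/subspace_continuousP => x xs.
  by apply: cvgM; [exact: cvg_cst|exact: cu].
rewrite /Rintegral (@continuous_FTC2 R _ F 0 s s_gt0 cGu).
- rewrite /F mulr0 Kfun0// ln1 sube0 /= lnK// posrE; exact: scaled_Kfun_gt0.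
- have [_ c0 c1] := (continuous_within_itvP F s_gt0).1 cF.
  split => // x; rewrite in_itv /= => /dF; by case.
- move=> x; rewrite in_itv /= => /dF; rewrite derive1E; by case.
Qed.

Lemma Linfty_norm_U : Linfty_norm T product_U = +oo%E.
Proof.
apply: Linfty_norm_eqy; first exact: sol_U_cont product_solution.
by move=> B; have [s [q [sT Bu]]] := product_U_unbounded B; exists s, q, w1.
Qed.

Lemma Linfty_norm_dqU : Linfty_norm T (dq product_U) = +oo%E.
Proof.
apply: Linfty_norm_eqy; first exact: sol_dqU_cont product_solution.
by move=> B; have [s [q [sT _ Bu]]] := dq_product_U_unbounded B; exists s, q, w1.
Qed.

Lemma Linfty_norm_kappa : Linfty_norm T (kappa G product_data product_U) = +oo%E.
Proof.
apply: Linfty_norm_eqy.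
  apply: subspace_eq_continuous scaled_Kfun_continuous => x; rewrite inE => -[xT cx].
  exact/esym/kappa_product.
move=> B; have [t [q [tT Bk]]] := Kfun_unbounded ha B.
have [s sT st] := unscale tT; exists s, q, w1; split=> //.
by rewrite kappa_product// st (lt_le_trans Bk)// ler_norm.
Qed.

End ProductData.

(** * The smooth datum and the conclusion *)

Section InitialDatum.
Context {R : realType}.

Definition bump (q : R) : R := flat 0 q * flat 0 (1 - q).

Lemma bump_profile : profile bump.
Proof.
split.
- move=> q; have c1 := @flat_continuous R 0 q.
  have c2 : {for q, continuous (fun q : R => flat 0 (1 - q))}.
    apply: (@continuous_comp _ _ _ (fun q : R => 1 - q) (flat 0)); last exact: flat_continuous.
    by apply: continuousB; [exact: cvg_cst|exact: cvg_id].
  exact: continuousM c1 c2.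
- by move=> q; rewrite mulr_ge0// flat_ge0.
- by move=> q; rewrite mulr_ile1 ?flat_ge0 ?flat0_le1.
- move=> q [q0|q1]; rewrite /bump; first by rewrite flat_le0// mul0r.
  by rewrite (@flat_le0 _ _ (1 - q)) ?mulr0//; lra.
(* On [[1/4, 1/2]] both [q] and [1 - q] are at least [1/4], so each factor is at least
   [exp (- 4)]. *)
- exists 4^-1, 2^-1, (expR (-4) * expR (-4)); split; first lra.
    by rewrite mulr_gt0// expR_gt0.
  have low (x : R) : 4^-1 <= x -> expR (-4) <= flat 0 x.
    move=> x4; have x0 : 0 < x by apply: lt_le_trans x4.
    by rewrite /flat x0 expr0 mul1r ler_expR lerN2 invf_ple// posrE.
  by move=> q /andP[q4 q2]; apply: ler_pM; rewrite ?expR_ge0//; apply: low; lra.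
Qed.

Context (g0 : 'M[R]_3).
Let G := Gfun g0.

Lemma elementary_sum (I : Type) (r : seq I) (F : I -> R -> R -> R) :
  (forall i, elementary (F i)) -> elementary (fun x y => \sum_(i <- r) F i x y).
Proof.
move=> eF; elim: r => [|i r IH].
  rewrite (_ : (fun x y => _) = fun _ _ => 0); first by constructor.
  by apply/funext => x; apply/funext => y; rewrite big_nil.
rewrite (_ : (fun x y => _) = fun x y => F i x y + \sum_(j <- r) F j x y).
  by constructor.
by apply/funext => x; apply/funext => y; rewrite big_cons.
Qed.

Lemma elementary_Gfun : elementary (fun _ t => G (angle t)).
Proof.
have eo (i : 'I_3) : elementary (fun _ t : R => omega_hat (angle t) i).
  by case: i => -[|[|[|//]]] i; rewrite /omega_hat /=; constructor.
by do 2 apply: elementary_sum => ?; do 2 (constructor; last exact: eo); constructor.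
Qed.

Lemma Gfun_continuous : continuous G.
Proof.
have co (i : 'I_3) : continuous (fun w : R * R => omega_hat w i).
  case: i => -[|[|[|//]]] i w; rewrite /omega_hat /=.
  - exact: cvg_cst.
  - exact: cvg_fst.
  - exact: cvg_snd.
move=> w; rewrite /G /Gfun.
apply: (@continuous_fun_sum R (R * R)%type) => i.
apply: (@continuous_fun_sum R (R * R)%type) => j.
by apply: cvgM; [apply: cvgM; [exact: cvg_cst|exact: co]|exact: co].
Qed.

(** Flatness at 0 makes the cutoff smooth across the zeros of [G], however [G] vanishes there. *)
Definition angular_cutoff (w : R * R) : R := flat 0 (- G w).

Lemma angular_cutoff_continuous : continuous angular_cutoff.
Proof.
move=> w; apply: (@continuous_comp _ _ _ (fun w => - G w) (flat 0)).
  by apply: continuousN; exact: Gfun_continuous.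
exact: flat_continuous.
Qed.

Lemma sigma_cutoff_ge0 w : 0 <= sigma G angular_cutoff w.
Proof.
rewrite /sigma; have [G0|/ltW G0] := leP 0 (G w).
  by rewrite /angular_cutoff flat_le0 ?oppr_le0// expr0n mulr0.
by rewrite mulr_ge0 ?oppr_ge0// sqr_ge0.
Qed.

Lemma sigma_cutoff_gt0 w : G w < 0 -> 0 < sigma G angular_cutoff w.
Proof. by move=> G0; rewrite mulr_gt0 ?exprn_gt0 ?flat_gt0 ?oppr_gt0. Qed.

Lemma sigma_cutoff_max : exists2 w1, circle w1 &
  forall w, circle w -> sigma G angular_cutoff w <= sigma G angular_cutoff w1.
Proof.
have cs := sigma_continuous Gfun_continuous angular_cutoff_continuous.
have pi0 : 0 <= 2 * pi :> R by rewrite mulr_ge0// ltW// pi_gt0.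
have [|t _ ht] := @EVT_max R (fun t => sigma G angular_cutoff (angle t)) 0 (2 * pi) pi0.
  apply: continuous_subspaceT => t.
  by apply: (@continuous_comp _ _ _ (@angle R)); [exact: angle_continuous|exact: cs].
exists (angle t); first exact: angle_circle.
move=> w /circle_angle[u /andP[u0 u1] ->]; apply: ht.
by rewrite in_itv /= u0 ltW.
Qed.

Lemma circle_compact : compact (@circle R).
Proof.
apply: (@subclosed_compact _ _ ([set` `[(-1 : R), 1]] `*` [set` `[(-1 : R), 1]])).
- apply: (@closed_comp _ _ (fun w : R * R => w.1 ^+ 2 + w.2 ^+ 2) [set 1]); last exact: closed_eq.
  move=> w _; apply: cvgD.
    by apply: (@continuous_comp _ _ _ fst (fun x : R => x ^+ 2));
      [exact: cvg_fst|exact: exprn_continuous].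
  by apply: (@continuous_comp _ _ _ snd (fun x : R => x ^+ 2));
      [exact: cvg_snd|exact: exprn_continuous].
- by apply: compact_setX; exact: segment_compact.
- by move=> [x y]; rewrite /circle /= => xy; rewrite !in_itv /=; split; nra.
Qed.

Lemma cyl_support_product_data b :
  cyl_support (product_data bump b) `<=` [set` `[0, 1]] `*` circle.
Proof.
have cS : compact ([set` `[(0 : R), 1]] `*` @circle R).
  by apply: compact_setX; [exact: segment_compact|exact: circle_compact].
have /closure_id -> := compact_closed (@norm_hausdorff R (R * (R * R))%type) cS.
apply: closure_subset => -[q w] [/= cw A0]; split=> //=; rewrite in_itv /=.
have out : ~ (q <= 0 \/ 1 <= q).
  by move=> /(product_data_out bump_profile) h; rewrite h eqxx in A0.
by apply/andP; split; rewrite leNgt; apply/negP => /ltW hq; apply: out; [left|right].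
Qed.

Lemma smooth_product_data : smooth_compact_support (product_data bump angular_cutoff).
Proof.
split.
  move=> k; apply: elementary_C_k.
  (* Differences and opposites are written with sums and products, the operations of the class
     [elementary]. *)
  rewrite (_ : (fun q t => _) = fun q t => flat 0 q * flat 0 (1 + -1 * q) *
      flat 0 (-1 * G (angle t))); last first.
    apply/funext => q; apply/funext => t.
    by rewrite /product_data /bump /angular_cutoff !mulN1r.
  constructor; first by repeat constructor.
  by do 2 constructor; [constructor|exact: elementary_Gfun].
apply: (subclosed_compact _ _ (@cyl_support_product_data angular_cutoff)).
  exact: closed_closure.
by apply: compact_setX; [exact: segment_compact|exact: circle_compact].
Qed.

End InitialDatum.

Theorem lemma3p7 (R : realType) (g : 'I_3 -> 'I_3 -> R -> R) (g0 : 'M[R]_3)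
    (hg : metric_coefficients g g0)
    (omega0 : R * R) (homega0 : circle omega0) (hG : Gfun g0 omega0 < 0) :
  exists A : R -> R * R -> R,
    [/\ smooth_compact_support A,
        cyl_support A `<=` [set x | x.1 <= 1] &
        exists (s_star : R) (mu U : R -> R -> R * R -> R),
          [/\ 0 < s_star,
              maximal_solution (Gfun g0) A s_star mu U,
              Linfty_norm s_star (kappa (Gfun g0) A U) = +oo%E,
              Linfty_norm s_star U = +oo%E &
              Linfty_norm s_star (dq U) = +oo%E]].
Proof.
have ha := @bump_profile R.
pose b := angular_cutoff g0; pose G := Gfun g0.
have cG : continuous G := @Gfun_continuous R g0.
have cb : continuous b := @angular_cutoff_continuous R g0.
have s0 w : 0 <= sigma G b w := sigma_cutoff_ge0 g0 w.
have [w1 cw1 w1_max] := sigma_cutoff_max g0.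
(* The hypothesis on [omega0] enters here: the maximum of [sigma] is at least its value at [omega0],
   which is positive since [G] is negative there. *)
have w1_gt0 : 0 < sigma G b w1.
  by apply: lt_le_trans (w1_max _ homega0); exact: sigma_cutoff_gt0.
exists (product_data bump b); split.
- exact: smooth_product_data.
- by move=> [q w] /cyl_support_product_data[/=]; rewrite in_itv /= => /andP[].
- exists (blowup_time bump G b w1), (product_mu bump G b), (product_U bump G b).
  split.
  + exact: blowup_time_gt0.
  + exact: product_maximal.
  + exact: Linfty_norm_kappa.
  + exact: Linfty_norm_U.
  + exact: Linfty_norm_dqU.
Qed.
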